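(* Let $\gamma>1$, $\mu,\lambda>0$. For every $\bar\rho(0)>0$ and $\bar\omega\ge0$, with $r=\sqrt{x_1^2+x_2^2}$, the uniformly rotating pair $$\bar\rho(x)=\Big(\bar\rho(0)^{\gamma-1}+\tfrac{\gamma-1}{2\gamma}\,\bar\omega^2r^2\Big)^{1/(\gamma-1)},\qquad \bar u(x)=\bar\omega\,(x_2,-x_1,0)^\top$$ is a solution with $\bar\rho>0$ of the stationary problem $$\mathrm{div}(\bar\rho\bar u)=0,\quad \mathrm{div}(\bar\rho\bar u\otimes\bar u)+\nabla\bar\rho^\gamma=\mathrm{div}\,\mathbb S(\bar u)\ \text{ in }\Omega,\qquad \bar u\cdot\vec n=0,\quad \vec\tau\cdot\mathbb S(\bar u)\vec n=0\ \text{ on }\Gamma .$$ Conversely, every smooth solution $(\bar\rho,\bar u)$ of this stationary problem with $\bar\rho>0$ satisfies $\nabla\bar u+\nabla\bar u^\top=0$ in $\Omega$ and $\bar u=x\times\bar a$ for some constant vector $\bar a\in\mathbb R^3$; and if $\bar a=\bar\omega e_3$ with $\bar\omega\ge0$, then $(\bar\rho,\bar u)$ is of the form displayed above, where $\bar\rho(0)>0$ is the value of $\bar\rho$ at $r=0$.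
   Context: $\Omega=B_1\subset\mathbb R^3$ is the unit ball centred at the origin, $\Gamma=\partial\Omega$, $\vec n$ is the unit outer normal and $\vec\tau$ denotes arbitrary tangential vectors on $\Gamma$; $\mathbb S(u)=\mu(\nabla u+\nabla u^\top)+\lambda(\mathrm{div}\,u)\,\mathbb I_3$; $e_3=(0,0,1)^\top$. *)

(* Defs.v *)
From HB Require Import structures.
From mathcomp Require Import all_boot all_order all_algebra.
From mathcomp Require Import all_classical all_reals all_analysis.

Set Implicit Arguments.
Unset Strict Implicit.
Unset Printing Implicit Defensive.

Import Order.TTheory GRing.Theory Num.Theory.
Import numFieldNormedType.Exports.

Local Open Scope classical_set_scope.
Local Open Scope ring_scope.

(** Points and vectors of R^3 are row vectors; the coordinates x_1, x_2, x_3
    are [x 0 0], [x 0 1], [x 0 2]. *)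

Definition dotv (R : realType) (v w : 'rV[R]_3) : R :=
  \sum_(i < 3) v 0 i * w 0 i.

(** The norm [`|x|] of the library on ['rV[R]_3] is the maximum norm, hence the
    Euclidean norm below. *)
Definition enorm (R : realType) (x : 'rV[R]_3) : R := Num.sqrt (dotv x x).

Definition vec3 (R : realType) (a b c : R) : 'rV[R]_3 :=
  \row_(i < 3) [:: a; b; c]`_i.

Definition crossv (R : realType) (v w : 'rV[R]_3) : 'rV[R]_3 :=
  vec3 (v 0 1 * w 0 2 - v 0 2 * w 0 1)
       (v 0 2 * w 0 0 - v 0 0 * w 0 2)
       (v 0 0 * w 0 1 - v 0 1 * w 0 0).

Definition Omega (R : realType) : set 'rV[R]_3 := [set x | enorm x < 1].

Definition Omega_bar (R : realType) : set 'rV[R]_3 := [set x | enorm x <= 1].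

Definition Gamma (R : realType) : set 'rV[R]_3 := [set x | enorm x = 1].

(** On the unit sphere the unit outer normal at x is x itself. *)
Definition normal (R : realType) (x : 'rV[R]_3) : 'rV[R]_3 := x.

Definition partial (R : realType) (j : 'I_3) (f : 'rV[R]_3 -> R) :
  'rV[R]_3 -> R := 'D_(delta_mx 0 j) f.

Definition grad (R : realType) (f : 'rV[R]_3 -> R) (x : 'rV[R]_3) : 'rV[R]_3 :=
  \row_(i < 3) partial i f x.

Definition div (R : realType) (u : 'rV[R]_3 -> 'rV[R]_3) (x : 'rV[R]_3) : R :=
  \sum_(i < 3) partial i (fun y => u y 0 i) x.

Definition gradv (R : realType) (u : 'rV[R]_3 -> 'rV[R]_3) (x : 'rV[R]_3) :
    'M[R]_3 :=
  \matrix_(i < 3, j < 3) partial j (fun y => u y 0 i) x.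

Definition divm (R : realType) (T : 'rV[R]_3 -> 'M[R]_3) (x : 'rV[R]_3) :
    'rV[R]_3 :=
  \row_(i < 3) \sum_(j < 3) partial j (fun y => T y i j) x.

Definition tensor (R : realType) (v w : 'rV[R]_3) : 'M[R]_3 := v^T *m w.

Definition stress (R : realType) (mu lambda : R) (u : 'rV[R]_3 -> 'rV[R]_3)
    (x : 'rV[R]_3) : 'M[R]_3 :=
  mu *: (gradv u x + (gradv u x)^T) + lambda *: (div u x)%:M.

(** Smoothness up to the boundary: f is C^oo in the open ball and each of its
    iterated partial derivatives extends continuously to the closed ball.
    [D s] is the (extended) derivative along the list of directions [s]. *)
Definition smooth (R : realType) (f : 'rV[R]_3 -> R) : Prop :=
  exists D : seq 'I_3 -> 'rV[R]_3 -> R,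
    [/\ D [::] = f,
        forall s, {within Omega_bar (R := R), continuous (D s)} &
        forall s i x, Omega x ->
          is_derive x (delta_mx 0 i : 'rV[R]_3) (D s) (D (i :: s) x)].

Definition smoothv (R : realType) (u : 'rV[R]_3 -> 'rV[R]_3) : Prop :=
  forall i, smooth (fun x => u x 0 i).

(** Boundary value of a function on the open ball.  The fields are only
    constrained on the closed ball, so derivatives at a point of the sphere are
    limits from the inside. *)
Definition trace (R : realType) (f : 'rV[R]_3 -> R) (x : 'rV[R]_3) : R :=
  lim (f y @[y --> within (Omega (R := R)) (nbhs x)]).

Definition tracem (R : realType) (T : 'rV[R]_3 -> 'M[R]_3) (x : 'rV[R]_3) :
    'M[R]_3 :=
  \matrix_(i < 3, j < 3) trace (fun y => T y i j) x.

(** A classical solution, smooth up to the boundary.  The row vector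
    [normal x *m S^T] is S n in the row convention. *)
Record stationary_solution (R : realType) (gamma mu lambda : R)
    (rho : 'rV[R]_3 -> R) (u : 'rV[R]_3 -> 'rV[R]_3) : Prop :=
  StationarySolution {
    sol_smooth_density : smooth rho;
    sol_smooth_velocity : smoothv u;
    sol_continuity : forall x, Omega x ->
      div (fun y => rho y *: u y) x = 0;
    sol_momentum : forall x, Omega x ->
      divm (fun y => rho y *: tensor (u y) (u y)) x
        + grad (fun y => rho y `^ gamma) x
      = divm (stress mu lambda u) x;
    sol_impermeable : forall x, Gamma x -> dotv (u x) (normal x) = 0;
    sol_slip : forall x tau, Gamma x -> dotv tau (normal x) = 0 ->
      dotv tau (normal x *m (tracem (stress mu lambda u) x)^T) = 0
  }.

Definition axis_dist (R : realType) (x : 'rV[R]_3) : R :=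
  Num.sqrt (x 0 0 ^+ 2 + x 0 1 ^+ 2).

Definition rotating_density (R : realType) (gamma rho0 omega : R)
    (x : 'rV[R]_3) : R :=
  (rho0 `^ (gamma - 1)
    + (gamma - 1) / (2 * gamma) * omega ^+ 2 * axis_dist x ^+ 2)
  `^ (1 / (gamma - 1)).

Definition rotating_velocity (R : realType) (omega : R) (x : 'rV[R]_3) :
    'rV[R]_3 :=
  omega *: vec3 (x 0 1) (- x 0 0) 0.

Definition e3 (R : realType) : 'rV[R]_3 := vec3 0 0 1.

(* Main.v *)
Require Import Defs.
From mathcomp Require Import all_boot all_order all_algebra.
From mathcomp Require Import all_classical all_reals all_analysis.
From mathcomp Require Import ring lra.

(** The energy flux F = -(rho |u|^2 / 2 + gamma / (gamma - 1) rho^gamma) u + S u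
    has divergence S : grad u >= 0 in the ball and vanishing normal component on
    the sphere; hence S : grad u = 0, the velocity gradient is constant and skew,
    and the momentum equation becomes an equation for grad rho^(gamma - 1).

    The divergence theorem is replaced by finite sums.  As the coefficients are
    smooth up to the boundary, |F(x).x| <= M (1 - |x|^2).  Multiplying F by the
    cutoff (1 + e ln (1 - |x|^2))_+^2 gives a compactly supported C^1 field G
    with div G >= cutoff * div F - 4 e M.  Summing the increments of G over a
    fine cubic lattice telescopes to 0, while by the mean value theorem the sum is
    a Riemann sum of div G; so div F > 0 at one point is impossible when e is
    small. *)

Set Implicit Arguments.
Unset Strict Implicit.
Unset Printing Implicit Defensive.

Import Order.TTheory GRing.Theory Num.Theory.
Import numFieldNormedType.Exports.

Local Open Scope classical_set_scope.
Local Open Scope ring_scope.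

(** * Points, the ball and directional derivatives *)


(** On the sphere F.x vanishes for two reasons: u.x = 0 by impermeability, and (S u).x = 0 by the
    slip condition tested with the tangential vector u itself. Positivity of rho is assumed only in
    the open ball, so powers of rho are differentiated only there; the bound by M (1 - |x|^2) is
    therefore proved for u.x and (S u).x separately, and the scalar factor in front of u enters
    through its boundedness alone.

    A cutoff falling linearly in a layer of thickness delta would produce an error of order one in
    that layer, to be absorbed by the small volume of the layer. The logarithm spreads the fall so
    that the error is at most 4 e M at every point: pointwise bounds then suffice and no integral is
    ever formed. The square makes the truncation at 0 differentiable.

    The density enters F as rho times the enthalpy gamma / (gamma - 1) rho^(gamma - 1), whose
    gradient is grad rho^gamma / rho; with the continuity equation this turns u . grad rho^gamma
    into a divergence. *)

Lemma ord3_ind (P : 'I_3 -> Prop) : P 0 -> P 1 -> P 2 -> forall i, P i.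
Proof.
move=> P0 P1 P2 [[|[|[|//]]] Hi].
- by rewrite (_ : Ordinal Hi = 0) //; apply: val_inj.
- by rewrite (_ : Ordinal Hi = 1) //; apply: val_inj.
- by rewrite (_ : Ordinal Hi = 2) //; apply: val_inj.
Qed.

Lemma sum3 (V : zmodType) (F : 'I_3 -> V) :
  \sum_(i < 3) F i = F 0 + F 1 + F 2.
Proof.
rewrite !big_ord_recl big_ord0 addr0 addrA.
by congr (F _ + F _ + F _); apply: val_inj.
Qed.

Section Space.
Variable R : realType.
Notation E := 'rV[R]_3.
Implicit Types (x y p : E) (f g : E -> R).

Definition evec (i : 'I_3) : E := delta_mx 0 i.

Definition sqnorm (x : E) : R := x 0 0 ^+ 2 + x 0 1 ^+ 2 + x 0 2 ^+ 2.

Lemma dotvE x y : dotv x y = x 0 0 * y 0 0 + x 0 1 * y 0 1 + x 0 2 * y 0 2.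
Proof. by rewrite /dotv sum3. Qed.

Lemma vec3E (a b c : R) :
  (vec3 a b c 0 0 = a) * (vec3 a b c 0 1 = b) * (vec3 a b c 0 2 = c).
Proof. by rewrite /vec3 !mxE. Qed.

Lemma rowP3 x y :
  x 0 0 = y 0 0 -> x 0 1 = y 0 1 -> x 0 2 = y 0 2 -> x = y.
Proof. by move=> h0 h1 h2; apply/rowP; apply: ord3_ind. Qed.

Lemma sqnorm_dotv x : dotv x x = sqnorm x.
Proof. by rewrite dotvE /sqnorm !expr2. Qed.

Lemma sqnorm_ge0 x : 0 <= sqnorm x.
Proof. by rewrite /sqnorm !addr_ge0 ?sqr_ge0. Qed.

Lemma OmegaE x : Omega x <-> sqnorm x < 1.
Proof. by rewrite /Omega /= /enorm sqnorm_dotv -{1}sqrtr1 ltr_sqrt. Qed.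

Lemma Omega_barE x : Omega_bar x <-> sqnorm x <= 1.
Proof. by rewrite /Omega_bar /= /enorm sqnorm_dotv -{1}sqrtr1 ler_sqrt. Qed.

Lemma GammaE x : Gamma x <-> sqnorm x = 1.
Proof.
rewrite /Gamma /= /enorm sqnorm_dotv; split=> [h|->]; last exact: sqrtr1.
by rewrite -(sqr_sqrtr (sqnorm_ge0 x)) h expr1n.
Qed.

Lemma Omega_sub_bar x : Omega x -> Omega_bar x.
Proof. by move=> /OmegaE /ltW /Omega_barE. Qed.

Lemma Gamma_sub_bar x : Gamma x -> Omega_bar x.
Proof. by move=> /GammaE h; apply/Omega_barE; rewrite h. Qed.

Lemma Omega_bar_cases x : Omega_bar x -> Omega x \/ Gamma x.
Proof.
move=> /Omega_barE; rewrite le_eqVlt => /orP[/eqP h|h].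
  by right; apply/GammaE.
by left; apply/OmegaE.
Qed.

Lemma Omega0 : Omega (0 : E).
Proof. by apply/OmegaE; rewrite /sqnorm !mxE !expr0n !addr0. Qed.

Lemma coord_cont i : continuous (fun x : E => x 0 i).
Proof. exact: (@coord_continuous R 1 3 0 i). Qed.

Lemma sqnorm_continuous : continuous sqnorm.
Proof.
move=> x; rewrite /continuous_at /sqnorm.
have c i : (fun y : E => y 0 i ^+ 2 : R) y @[y --> x] --> x 0 i ^+ 2.
  exact: (cvgM (@coord_cont i x) (@coord_cont i x)).
exact: (cvgD (cvgD (c 0) (c 1)) (c 2)).
Qed.

Lemma Omega_open : open (@Omega R).
Proof.
rewrite (_ : @Omega R = sqnorm @^-1` [set r | r < 1]).
  by apply: open_comp; [move=> x _; exact: sqnorm_continuous|exact: open_lt].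
by apply/seteqP; split=> x /OmegaE.
Qed.

Lemma near_Omega x : Omega x -> \forall y \near x, Omega y.
Proof. by move=> Ox; exact: open_nbhs_nbhs (conj Omega_open Ox). Qed.

Lemma sqr_coord_le x i : x 0 i ^+ 2 <= sqnorm x.
Proof.
move: i; rewrite /sqnorm.
have h i : 0 <= x 0 i ^+ 2 by rewrite sqr_ge0.
by apply: ord3_ind; move: (h 0) (h 1) (h 2); lra.
Qed.

Lemma mx_norm_le x (M : R) : 0 <= M -> (forall i, `|x 0 i| <= M) -> `|x| <= M.
Proof.
move=> M0 h; rewrite /Num.Def.normr /= mx_normrE; apply/bigmax_leP; split => //= -[i j] _.
by rewrite ord1.
Qed.

Lemma Omega_bar_compact : compact (@Omega_bar R).
Proof.
apply: bounded_closed_compact.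
  exists 1; split => // M M1 x /Omega_barE xO.
  apply: mx_norm_le; first lra.
  move=> i; have := sqr_coord_le x i => h.
  have : `|x 0 i| ^+ 2 <= 1 by rewrite real_normK ?num_real //; lra.
  by have := normr_ge0 (x 0 i); nra.
rewrite (_ : @Omega_bar R = sqnorm @^-1` [set r | r <= 1]).
  by apply: closed_comp; [move=> x _; exact: sqnorm_continuous|exact: closed_le].
by apply/seteqP; split=> x /Omega_barE.
Qed.

(** The two difference quotients are the same function of the increment, so one-variable results
    carry over to directional derivatives without any total differentiability. *)
Lemma is_derive_line f p v t d :
  is_derive (t *: v + p) v f d <->
  is_derive t (1 : R) (fun s : R => f (s *: v + p)) d.
Proof.
pose g1 h := h^-1 *: ((f \o shift (t *: v + p)) (h *: v) - f (t *: v + p)).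
pose g2 h := h^-1 *: (((fun s : R => f (s *: v + p)) \o shift t) (h *: 1)
   - f (t *: v + p)).
have E12 : g1 = g2.
  apply/funext => h; rewrite /g1 /g2 /=; congr (_ *: (f _ - _)).
  by rewrite (_ : h *: (1 : R) = h) ?scalerDl ?addrA //; exact: mulr1.
split => -[].
- rewrite /derivable /derive -/g1 E12 => h1 h2; split; first exact: h1.
  by rewrite /derive -/g2.
- rewrite /derivable /derive -/g2 -E12 => h1 h2; split; first exact: h1.
  by rewrite /derive -/g1.
Qed.

Lemma is_derive_comp1 (g : R -> R) f x v a d :
  is_derive (f x) 1 g a -> is_derive x v f d ->
  is_derive x v (fun y => g (f y)) (a * d).
Proof.
move=> dg df.
have e0 : x = 0 *: v + x by rewrite scale0r add0r.
rewrite e0; apply/is_derive_line.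
apply: (@is_derive1_comp R g (fun s => f (s *: v + x))); rewrite -?e0 //.
by apply/is_derive_line; rewrite -e0.
Qed.

Lemma is_derive_mulr (c s : R) : is_derive s 1 (fun t : R => t * c) c.
Proof.
have := @is_deriveM _ _ id (cst c) s 1 1 0 (is_derive_id _ _) (is_derive_cst _ _ _).
move=> h; apply: (is_derive_eq h); rewrite scaler0 add0r; exact: mulr1.
Qed.

(** Parametrising by [s] in [0, 1] treats both signs of [c] at once. Differentiability is asked only
    inside the segment because an endpoint may lie on the sphere. *)
Lemma mvt_line f (f' : E -> R) p v (c : R) :
  (forall s, 0 < s < 1 -> is_derive ((s * c) *: v + p) v f (f' ((s * c) *: v + p))) ->
  {within `[0, 1], continuous (fun s : R => f ((s * c) *: v + p))} ->
  exists2 s, 0 < s < 1 & f (c *: v + p) - f p = c * f' ((s * c) *: v + p).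
Proof.
move=> df cf.
have dfc (s : R) : s \in `]0, 1[ -> is_derive s 1 (fun s : R => f ((s * c) *: v + p))
    (f' ((s * c) *: v + p) * c).
  rewrite in_itv /= => /df /is_derive_line h.
  apply: (@is_derive1_comp R (fun t => f (t *: v + p)) (fun s => s * c)) => //.
  exact: is_derive_mulr.
have [s + e] := @MVT R _ _ 0 1 ltr01 dfc cf.
rewrite in_itv /= => s01; exists s => //; move: e.
by rewrite mul1r mul0r scale0r add0r subr0 mulr1 mulrC.
Qed.

Lemma mvt_segment f (f' : E -> R) p v (c : R) :
  (forall s, 0 <= s <= 1 -> is_derive ((s * c) *: v + p) v f (f' ((s * c) *: v + p))) ->
  exists2 s, 0 <= s <= 1 & f (c *: v + p) - f p = c * f' ((s * c) *: v + p).
Proof.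
move=> df; case: (@mvt_line f f' p v c).
- by move=> s /andP[s0 s1]; apply: df; rewrite !ltW.
- apply: derivable_within_continuous => s; rewrite in_itv /= => /df /is_derive_line h.
  by case: (@is_derive1_comp R (fun t => f (t *: v + p)) (fun s => s * c) s _ c h (is_derive_mulr c s)).
- by move=> s /andP[s0 s1] e; exists s => //; rewrite !ltW.
Qed.

End Space.

(** * Lattice sums of a compactly supported divergence *)


Section Lattice.
Variable R : realType.
Notation E := 'rV[R]_3.
Implicit Types (x y p : E) (f g : E -> R).

Definition cube : set E := [set x | forall i, x ord0 i \in `[(-1 : R), 1]].

Lemma cube_compact : compact cube.
Proof.
apply: (@rV_compact R 3 (fun=> `[(-1 : R), 1]%classic)).
by move=> _; exact: segment_compact.
Qed.

(** Each point of [K] with its radius [r] contributes the ball of radius [r / 2] and the steps below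
    [r / 2]; compactness makes one step size work for all. Only [x] is confined to [K], so
    intermediate points need no membership check. *)
Lemma compact_unif_cont (K : set E) f : compact K -> continuous f ->
  forall e, 0 < e -> exists2 d, 0 < d &
  forall x y, K x -> `|y - x| < d -> `|f y - f x| < e.
Proof.
move=> /compact_near_coveringP cK cf e e0.
have [|d /= d0 hd] := cK R ((0:R)^'+) (fun d x => forall y, `|y - x| < d -> `|f y - f x| < e) _.
  move=> x Kx.
  have /(@cvgr_dist_lt _ R E) /(_ (e / 2) ltac:(by rewrite divr_gt0)) := cf x.
  move=> /nbhs_normP [r /= r0 hr].
  exists (ball x (r / 2), [set d | d < r / 2]).
    split => /=; first by apply: nbhsx_ballx; rewrite divr_gt0.
    by apply: nbhs_right_lt; rewrite divr_gt0.
  move=> [x' d] /= [+ dr] y yd; rewrite -ball_normE /= => xx'.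
  have h1 : `|f x - f x'| < e / 2.
    by apply: hr => /=; apply: lt_trans xx' _; lra.
  have h2 : `|f x - f y| < e / 2.
    apply: hr => /=; have -> : x - y = (x - x') - (y - x').
      by rewrite opprB addrA subrK.
    by apply: le_lt_trans (ler_normB _ _) _; lra.
  have -> : f y - f x' = (f x - f x') - (f x - f y) by ring.
  by apply: le_lt_trans (ler_normB _ _) _; lra.
exists (d / 2); first lra.
move=> x y Kx; apply: (hd (d / 2)) => //=; last lra.
by rewrite sub0r normrN gtr0_norm; lra.
Qed.

Definition node (N k : nat) : R := -1 + 2 / N%:R * k%:R.

Lemma nodeS N k : node N k.+1 = node N k + 2 / N%:R.
Proof. by rewrite /node -natr1; ring. Qed.

Lemma node0 N : node N 0 = -1.
Proof. by rewrite /node mulr0 addr0. Qed.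

Lemma nodeN N : (0 < N)%N -> node N N = 1.
Proof.
move=> N0; rewrite /node -mulrA mulVf ?mulr1; last by rewrite pnatr_eq0 -lt0n.
by ring.
Qed.

Lemma node_itv N k : (k <= N)%N -> -1 <= node N k <= 1.
Proof.
case: N => [|N] kN.
  by move: kN; rewrite leqn0 => /eqP ->; rewrite node0; lra.
have h : (0 : R) <= 2 / N.+1%:R by rewrite divr_ge0.
apply/andP; split; first by rewrite /node lerDl mulr_ge0.
rewrite -[leRHS](@nodeN N.+1) // /node lerD2l.
by rewrite ler_wpM2l // ler_nat.
Qed.

(** The clamp [T] onto [t - l/2, t + l/2] increases by [l] in total. One mesh step raises it by at
    most [2 / N], and by nothing when the node is further than [l] from [t], since the step is at
    most [l / 2]. *)
Lemma count_nodes N (t l : R) : (0 < N)%N -> 0 < l -> -1 <= t - l -> t + l <= 1 ->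
  2 / N%:R <= l / 2 ->
  l <= 2 / N%:R * \sum_(0 <= k < N) (`|node N k - t| <= l)%R%:R.
Proof.
move=> N0 l0 tl1 tl2 hl.
pose T s := Num.min (Num.max s (t - l / 2)) (t + l / 2).
have lE : l = \sum_(0 <= k < N) (T (node N k.+1) - T (node N k)).
  rewrite telescope_sumr // node0 nodeN // /T.
  by rewrite (@max_l _ _ 1) ?(@max_r _ _ (-1)) ?(@min_r _ _ 1) ?min_l; lra.
rewrite [leLHS]lE {lE}.
rewrite mulr_sumr; apply: ler_sum => k _.
have h0 : (0 : R) < 2 / N%:R by rewrite divr_gt0 // ltr0n.
rewrite nodeS; move: (node N k) (2 / N%:R) hl h0 => s h hl h0.
have T_spec u : [/\ u <= t - l / 2 & T u = t - l / 2] \/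
    [/\ t - l / 2 <= u <= t + l / 2 & T u = u] \/ [/\ t + l / 2 <= u & T u = t + l / 2].
  rewrite /T; case: (leP u (t - l / 2)) => h1; first by rewrite min_l; [left|lra].
  by case: (leP u (t + l / 2)) => h2; right; [left|right]; split=> //; lra.
have Ts := T_spec s; have Tsh := T_spec (s + h).
case: (boolP (`|s - t| <= l)) => H.
  rewrite /= mulr1n mulr1; move: H; rewrite ler_norml => /andP[H1 H2].
  by case: Ts => [[? ->]|[[? ->]|[? ->]]]; case: Tsh => [[? ->]|[[? ->]|[? ->]]]; lra.
rewrite /= mulr0n mulr0; move: H; rewrite -ltNge lter_normr.
by case: Ts => [[? ->]|[[? ->]|[? ->]]]; case: Tsh => [[? ->]|[[? ->]|[? ->]]];
  move=> /orP[?|?]; lra.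
Qed.

Lemma sum_nat_le (N : nat) (F : nat -> R) B : (forall k, (k < N)%N -> F k <= B) ->
  \sum_(0 <= k < N) F k <= N%:R * B.
Proof.
move=> h; rewrite big_nat.
apply: le_trans (_ : \sum_(0 <= k < N | (0 <= k < N)%N) B <= _).
  by apply: ler_sum => k /andP[_ kN]; exact: h.
by rewrite -big_nat sumr_const_nat subn0 mulr_natl.
Qed.

(* The differences of [g] along a lattice line telescope to zero. *)
Lemma sum_line_le (N : nat) (i : 'I_3) (g H : E -> R) (q : nat -> E) (e d : R) :
  (0 < N)%N -> 2 / N%:R < d ->
  (forall x, is_derive x (evec R i) g (H x)) ->
  (forall x y, cube x -> `|y - x| < d -> `|H y - H x| < e) ->
  (forall k, q k.+1 = (2 / N%:R) *: evec R i + q k) ->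
  (forall k, (k < N)%N -> cube (q k)) ->
  g (q 0) = 0 -> g (q N) = 0 ->
  \sum_(0 <= k < N) H (q k) <= N%:R * e.
Proof.
move=> N0 hd dg uH qS qK g0 gN.
have h0 : (0 : R) < 2 / N%:R by rewrite divr_gt0 // ltr0n.
have step k : (k < N)%N -> H (q k) - e <= (2 / N%:R)^-1 * (g (q k.+1) - g (q k)).
  move=> kN; rewrite qS.
  have [s /andP[s0 s1] ->] := @mvt_segment R g H (q k) (evec R i) (2 / N%:R)
    (fun s _ => dg _).
  rewrite mulKf ?gt_eqF //.
  have := uH (q k) ((s * (2 / N%:R)) *: evec R i + q k) (qK _ kN).
  rewrite addrK; set y := H (_ + _) => hy.
  suff /hy : `|(s * (2 / N%:R)) *: evec R i| < d by rewrite ltr_norml; lra.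
  apply: le_lt_trans hd; apply: mx_norm_le; first exact: ltW.
  move=> j; rewrite !mxE normrM [X in X * _]ger0_norm; last by rewrite mulr_ge0 // ltW.
  rewrite -[leRHS]mulr1; apply: ler_pM => //.
  - by rewrite mulr_ge0 // ltW.
  - by rewrite ler_piMl // ltW.
  - by rewrite eqxx /=; case: (j == i); rewrite ?normr1 // normr0.
suff : \sum_(0 <= k < N) (H (q k) - e) <= 0.
  by rewrite big_split /= sumr_const_nat subn0 mulr_natl mulNrn; lra.
apply: le_trans (_ : \sum_(0 <= k < N) (2 / N%:R)^-1 * (g (q k.+1) - g (q k)) <= _).
  by rewrite big_nat [leRHS]big_nat; apply: ler_sum => k /andP[_]; exact: step.
by rewrite -mulr_sumr telescope_sumr // g0 gN subrr mulr0.
Qed.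

Let pt N i j k : E := vec3 (node N i) (node N j) (node N k).

Lemma cube_pt N i j k : (i < N)%N -> (j < N)%N -> (k < N)%N -> cube (pt N i j k).
Proof.
move=> iN jN kN; have h := vec3E (node N i) (node N j) (node N k).
by apply: ord3_ind; rewrite in_itv /= /pt h node_itv // ltnW.
Qed.

Lemma sqnorm_vec3 (a b c : R) : sqnorm (vec3 a b c) = a ^+ 2 + b ^+ 2 + c ^+ 2.
Proof. by rewrite /sqnorm !vec3E. Qed.

Lemma not_Omega_sqr (a b c : R) : 1 <= a ^+ 2 + b ^+ 2 + c ^+ 2 -> ~ Omega (vec3 a b c).
Proof. by move=> h /OmegaE; rewrite sqnorm_vec3; lra. Qed.

(* Sum the three directional differences of [G] over the lattice of mesh [2/N]:
   the total telescopes to zero and is a Riemann sum of the divergence. *)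
Lemma divergence_box_le (G H : 'I_3 -> E -> R) x0 (l c d : R) :
  (forall i x, is_derive x (evec R i) (G i) (H i x)) ->
  (forall i, continuous (H i)) ->
  (forall i x, ~ Omega x -> G i x = 0) ->
  0 < l -> (forall i, -1 <= x0 0 i - l) -> (forall i, x0 0 i + l <= 1) ->
  0 <= c ->
  (forall x, cube x -> - d <= \sum_(i < 3) H i x) ->
  (forall x, (forall i, `|x 0 i - x0 0 i| <= l) -> c - d <= \sum_(i < 3) H i x) ->
  c * l ^+ 3 <= 8 * d.
Proof.
move=> dG cH G0 l0 lb ub c0 Hd Hc.
(* 24 = 8 * 3: each of the three directions costs [N ^ 3 * e], and the mesh volume [(2 / N) ^ 3]
   turns [N ^ 3] into 8. *)
apply/ler_addgt0Pr => e0 e0_gt0; pose e := e0 / 24.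
have e_gt0 : 0 < e by rewrite divr_gt0.
have u i := @compact_unif_cont cube (H i) cube_compact (cH i) e e_gt0.
have [d0 d0p u0] := u 0; have [d1 d1p u1] := u 1; have [d2 d2p u2] := u 2.
pose m := Num.min (Num.min d0 d1) (Num.min d2 (l / 2)).
have m0 : 0 < m by rewrite /m !lt_min; apply/andP; split; apply/andP; split => //; lra.
pose N := (Num.bound (2 / m)).+1.
have N0 : (0 < N)%N by [].
have hm : 2 / N%:R < m.
  have hb : 2 / m < N%:R.
    apply: lt_trans (archi_boundP _) _; first by rewrite divr_ge0 // ltW.
    by rewrite ltr_nat.
  by rewrite ltr_pdivrMr ?ltr0n // mulrC -ltr_pdivrMr.
have [[hm0 hm1] [hm2 hml]] : (2 / N%:R < d0 /\ 2 / N%:R < d1) /\ (2 / N%:R < d2 /\ 2 / N%:R < l / 2).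
  by move: hm; rewrite /m !lt_min => /andP[/andP[-> ->] /andP[-> ->]].
pose S (F : nat -> nat -> nat -> R) :=
  \sum_(0 <= i < N) \sum_(0 <= j < N) \sum_(0 <= k < N) F i j k.
have sq1 a b : (1 : R) <= (-1) ^+ 2 + a ^+ 2 + b ^+ 2.
  by have := sqr_ge0 a; have := sqr_ge0 b; rewrite sqrrN expr1n; lra.
have S0 : S (fun i j k => H 0 (pt N i j k)) <= N%:R * (N%:R * (N%:R * e)).
  rewrite /S exchange_big /=; apply: sum_nat_le => j jN.
  rewrite exchange_big /=; apply: sum_nat_le => k kN.
  apply: (@sum_line_le N 0 (G 0) (H 0) (fun i => pt N i j k) e d0) => //.
  - by move=> i; apply: rowP3; rewrite /pt !mxE /= ?nodeS; ring.
  - by move=> i iN; exact: cube_pt.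
  - apply: G0; apply: not_Omega_sqr; rewrite node0; exact: sq1.
  - apply: G0; apply: not_Omega_sqr; rewrite nodeN //.
    by have := sq1 (node N j) (node N k); rewrite sqrrN.
have S1 : S (fun i j k => H 1 (pt N i j k)) <= N%:R * (N%:R * (N%:R * e)).
  rewrite /S; apply: sum_nat_le => i iN.
  rewrite exchange_big /=; apply: sum_nat_le => k kN.
  apply: (@sum_line_le N 1 (G 1) (H 1) (fun j => pt N i j k) e d1) => //.
  - by move=> j; apply: rowP3; rewrite /pt !mxE /= ?nodeS; ring.
  - by move=> j jN; exact: cube_pt.
  - apply: G0; apply: not_Omega_sqr; rewrite node0.
    by have := sq1 (node N i) (node N k); lra.
  - apply: G0; apply: not_Omega_sqr; rewrite nodeN //.
    by have := sq1 (node N i) (node N k); rewrite sqrrN; lra.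
have S2 : S (fun i j k => H 2 (pt N i j k)) <= N%:R * (N%:R * (N%:R * e)).
  rewrite /S; apply: sum_nat_le => i iN; apply: sum_nat_le => j jN.
  apply: (@sum_line_le N 2 (G 2) (H 2) (fun k => pt N i j k) e d2) => //.
  - by move=> k; apply: rowP3; rewrite /pt !mxE /= ?nodeS; ring.
  - by move=> k kN; exact: cube_pt.
  - apply: G0; apply: not_Omega_sqr; rewrite node0.
    by have := sq1 (node N i) (node N j); lra.
  - apply: G0; apply: not_Omega_sqr; rewrite nodeN //.
    by have := sq1 (node N i) (node N j); rewrite sqrrN; lra.
(* With one indicator per coordinate the lower bound has product form, and its triple sum factors
   into three node counts. *)
pose b (a : 'I_3) k : R := (`|node N k - x0 0 a| <= l)%R%:R.
have Slow : S (fun i j k => c * b 0 i * b 1 j * b 2 k + - d) <=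
    S (fun i j k => H 0 (pt N i j k) + H 1 (pt N i j k) + H 2 (pt N i j k)).
  rewrite /S big_nat [leRHS]big_nat; apply: ler_sum => i /andP[_ iN].
  rewrite big_nat [leRHS]big_nat; apply: ler_sum => j /andP[_ jN].
  rewrite big_nat [leRHS]big_nat; apply: ler_sum => k /andP[_ kN].
  have low := Hd _ (cube_pt iN jN kN); rewrite sum3 in low.
  rewrite /b; case: (boolP (_ <= l)) => hi; last by rewrite mulr0 !mul0r add0r.
  case: (boolP (_ <= l)) => hj; last by rewrite mulr0 !mul0r add0r.
  case: (boolP (_ <= l)) => hk; last by rewrite mulr0 add0r.
  rewrite !mulr1; have := Hc (pt N i j k); rewrite sum3; apply.
  by apply: ord3_ind; rewrite /pt vec3E.
have Ssum : S (fun i j k => H 0 (pt N i j k) + H 1 (pt N i j k) + H 2 (pt N i j k))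
   = S (fun i j k => H 0 (pt N i j k)) + S (fun i j k => H 1 (pt N i j k))
     + S (fun i j k => H 2 (pt N i j k)).
  rewrite /S -!big_split; apply: eq_bigr => i _; rewrite -!big_split.
  by apply: eq_bigr => j _; rewrite -!big_split.
pose n a := \sum_(0 <= k < N) b a k.
have Sb : S (fun i j k => c * b 0 i * b 1 j * b 2 k + - d) =
    c * n 0 * n 1 * n 2 - N%:R * (N%:R * (N%:R * d)).
  have L a r (f : nat -> R) :
      \sum_(0 <= k < N) (a * f k + - r) = a * (\sum_(0 <= k < N) f k) - N%:R * r.
    by rewrite big_split /= -mulr_sumr sumr_const_nat subn0 mulNrn mulr_natl.
  have -> : c * n 0 * n 1 * n 2 = c * n 1 * n 2 * n 0 by ring.
  rewrite -L; apply: eq_bigr => i _.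
  have -> : c * n 1 * n 2 * b 0 i = c * n 2 * b 0 i * n 1 by ring.
  rewrite -L; apply: eq_bigr => j _.
  have -> : c * n 2 * b 0 i * b 1 j = c * b 0 i * b 1 j * n 2 by ring.
  by rewrite -L.
have hn a : l <= 2 / N%:R * n a by apply: count_nodes => //; lra.
rewrite Ssum Sb in Slow.
have Np : (0 : R) < N%:R by rewrite ltr0n.
have nN : c * n 0 * n 1 * n 2 <= N%:R ^+ 3 * (d + 3 * e).
  have -> : N%:R ^+ 3 * (d + 3 * e) = N%:R * (N%:R * (N%:R * d)) + 3 * (N%:R * (N%:R * (N%:R * e))).
    by ring.
  by lra.
have l3 : l ^+ 3 <= (2 / N%:R) ^+ 3 * (n 0 * n 1 * n 2).
  have -> : (2 / N%:R) ^+ 3 * (n 0 * n 1 * n 2) =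
     (2 / N%:R * n 0) * (2 / N%:R * n 1) * (2 / N%:R * n 2) by ring.
  rewrite !exprSr expr0 mul1r; have l0' := ltW l0.
  by apply: ler_pM => //; [rewrite mulr_ge0|apply: ler_pM].
apply: le_trans (ler_wpM2l c0 l3) _.
have -> : c * ((2 / N%:R) ^+ 3 * (n 0 * n 1 * n 2)) = (2 / N%:R) ^+ 3 * (c * n 0 * n 1 * n 2).
  by ring.
apply: le_trans (ler_wpM2l _ nN) _; first by rewrite exprn_ge0 // divr_ge0.
have -> : (2 / N%:R) ^+ 3 * (N%:R ^+ 3 * (d + 3 * e)) = 8 * (d + 3 * e).
  by rewrite /e; field; rewrite gt_eqF.
by rewrite /e; lra.
Qed.

End Lattice.

(** * Functions that are C^1 up to the boundary *)


Section C1.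
Variable R : realType.
Notation E := 'rV[R]_3.
Implicit Types (x y p : E) (A : set E).

Lemma within_contD A (f g : E -> R) : {within A, continuous f} -> {within A, continuous g} ->
  {within A, continuous (fun x => f x + g x)}.
Proof. by move=> cf cg x; exact: (cvgD (cf x) (cg x)). Qed.

Lemma within_contM A (f g : E -> R) : {within A, continuous f} -> {within A, continuous g} ->
  {within A, continuous (fun x => f x * g x)}.
Proof. by move=> cf cg x; exact: (cvgM (cf x) (cg x)). Qed.

Lemma within_cont_comp (A : set R) (B : set E) (h : R -> E) (f : E -> R) :
  continuous h -> (forall s, A s -> B (h s)) -> {within B, continuous f} ->
  {within A, continuous (fun s => f (h s))}.
Proof.
move=> ch AB /subspace_continuousP cf; apply/subspace_continuousP => s As.
apply: (@cvg_comp _ _ _ h f _ (within B (nbhs (h s))) _ _ (cf _ (AB _ As))).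
move=> W; rewrite /within /= => hW; have := ch s _ hW.
move=> H; change (nbhs s (fun t => A t -> W (h t))).
by move: H; apply: (@filterS _ (nbhs s)) => t /= H At; apply: H; exact: AB.
Qed.

Lemma within_Omega_cont (f : E -> R) x :
  {within @Omega R, continuous f} -> Omega x -> {for x, continuous f}.
Proof.
rewrite continuous_open_subspace; last exact: Omega_open.
by move=> /(_ x); rewrite inE.
Qed.

Lemma within_bounded (f : E -> R) : {within @Omega_bar R, continuous f} ->
  exists2 M, 0 < M & forall x, Omega_bar x -> `|f x| <= M.
Proof.
move=> cf; have := compact_bounded (continuous_compact cf (@Omega_bar_compact R)).
move=> [M0 [_ hM]]; exists (Num.max M0 0 + 1); first by rewrite ltr_wpDl // le_max lexx orbT.
move=> x Ox; apply: (hM (Num.max M0 0 + 1)); last by exists x.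
by rewrite (le_lt_trans (_ : _ <= Num.max M0 0)) ?le_max ?lexx // ltrDl.
Qed.

Lemma sqnormZ (s : R) x : sqnorm (s *: x) = s ^+ 2 * sqnorm x.
Proof. by rewrite /sqnorm !mxE; ring. Qed.

Lemma scale_continuous x : continuous (fun s : R => s *: x).
Proof. by move=> s; apply: cvgZr_tmp; exact: cvg_id. Qed.

Lemma line_continuous (c : R) v p : continuous (fun s : R => (s * c) *: v + p).
Proof.
move=> s; apply: cvgD; last exact: cvg_cst.
have h : (fun t : R => t * c) t @[t --> s] --> s * c.
  by apply: cvgM; [exact: cvg_id|exact: cvg_cst].
exact: (cvgZr_tmp h).
Qed.

(** Properness makes the limit in [trace] unique. The ball is reached radially, through [s *: x]
    with [s] tending to 1 from below. *)
Lemma Gamma_proper x : Gamma x -> ProperFilter (within (@Omega R) (nbhs x)).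
Proof.
move=> /GammaE Gx; apply: Build_ProperFilter_ex => P; rewrite /within /= => hP.
have c1 : (fun s : R => s *: x) s @[s --> (1:R)] --> x.
  by rewrite -[X in _ --> X]scale1r; exact: scale_continuous.
have H : \forall s \near ((1:R)^'-), Omega (s *: x) -> P (s *: x).
  by apply: cvg_at_left_filter hP; exact: c1.
have [s [[s0 s1] Hs]] : exists s : R, (0 < s /\ s < 1) /\ (Omega (s *: x) -> P (s *: x)).
  apply: (@filter_ex _ ((1:R)^'-)).
  apply: filterI H; apply: filterI; first exact: nbhs_left_gt.
  exact: nbhs_left_lt.
exists (s *: x); apply: Hs; apply/OmegaE; rewrite sqnormZ Gx mulr1.
by rewrite expr_lt1 // ltW.
Qed.

Lemma Gamma_cvg (f : E -> R) x : {within @Omega_bar R, continuous f} -> Gamma x ->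
  f y @[y --> within (@Omega R) (nbhs x)] --> f x.
Proof.
move=> /subspace_continuousP cf Gx; have := cf x (Gamma_sub_bar Gx).
apply: cvg_trans; apply: cvg_app; apply: within_subset => y.
exact: Omega_sub_bar.
Qed.

Lemma trace_cont (f g : E -> R) x : {within @Omega_bar R, continuous f} ->
  (forall y, Omega y -> g y = f y) -> Gamma x -> trace g x = f x.
Proof.
move=> cf fg Gx; rewrite /trace; have P := Gamma_proper Gx.
apply: cvg_lim => //; apply: cvg_trans (Gamma_cvg cf Gx).
apply: near_eq_cvg; rewrite near_withinE; apply: nearW => y Oy; exact/esym/fg.
Qed.

Lemma eq_Omega_bar (f g : E -> R) : {within @Omega_bar R, continuous f} ->
  {within @Omega_bar R, continuous g} ->
  (forall y, Omega y -> f y = g y) -> forall x, Omega_bar x -> f x = g x.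
Proof.
move=> cf cg fg x /Omega_bar_cases [/fg//|Gx].
by rewrite -(trace_cont cg fg Gx) (trace_cont cf (fun _ _ => erefl)).
Qed.

(** [A] governs continuity only, while derivatives are taken in the open ball: the closed ball
    serves for the given fields, the open ball for powers of the density, the whole space for
    explicit formulas. *)
Definition C1 A (f : E -> R) (f' : 'I_3 -> E -> R) : Prop :=
  [/\ {within A, continuous f}, forall i, {within A, continuous (f' i)} &
      forall i x, Omega x -> is_derive x (evec R i) f (f' i x)].

Lemma C1W A f f' : @Omega R `<=` A -> C1 A f f' -> C1 (@Omega R) f f'.
Proof.
move=> OA [c c' d]; split => //; first exact: (continuous_subspaceW OA c).
by move=> i; exact: (continuous_subspaceW OA (c' i)).
Qed.

Lemma C1_cst A (c : R) : C1 A (fun=> c) (fun _ _ => 0).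
Proof.
split=> [|i|i x _]; [| |exact: is_derive_cst].
- by apply: continuous_subspaceT; exact: cst_continuous.
- by apply: continuous_subspaceT; exact: cst_continuous.
Qed.

Lemma is_derive_coord x v j : is_derive x v (fun y : E => y 0 j) (v 0 j).
Proof.
have -> : x = 0 *: v + x by rewrite scale0r add0r.
apply/is_derive_line.
have -> : (fun s : R => (s *: v + x) 0 j) = (fun s => s * v 0 j) + cst (x 0 j).
  by apply/funext => s; rewrite !mxE.
have h := is_deriveD (is_derive_mulr (v 0 j) 0) (is_derive_cst (x 0 j) (0:R) 1).
by apply: (is_derive_eq h); rewrite addr0.
Qed.

Lemma C1_coord A j : C1 A (fun x => x 0 j) (fun i _ => (i == j)%:R).
Proof.
split=> [|i|i x _].
- exact/continuous_subspaceT/coord_cont.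
- by apply: continuous_subspaceT; exact: cst_continuous.
- have h := is_derive_coord x (evec R i) j; apply: (is_derive_eq h).
  by rewrite /evec mxE eqxx eq_sym.
Qed.

Lemma C1D A f f' g g' : C1 A f f' -> C1 A g g' ->
  C1 A (fun x => f x + g x) (fun i x => f' i x + g' i x).
Proof.
move=> [cf cf' df] [cg cg' dg]; split=> [|i|i x Ox].
- exact: within_contD.
- exact: within_contD.
- exact: is_deriveD (df i x Ox) (dg i x Ox).
Qed.

Lemma C1M A f f' g g' : C1 A f f' -> C1 A g g' ->
  C1 A (fun x => f x * g x) (fun i x => f x * g' i x + g x * f' i x).
Proof.
move=> [cf cf' df] [cg cg' dg]; split=> [|i|i x Ox].
- exact: within_contM.
- by apply: within_contD; exact: within_contM.
- exact: is_deriveM (df i x Ox) (dg i x Ox).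
Qed.

Lemma C1Z A (c : R) f f' : C1 A f f' -> C1 A (fun x => c * f x) (fun i x => c * f' i x).
Proof.
move=> [cf cf' df]; split=> [|i|i x Ox].
- by apply: within_contM => //; have [] := C1_cst A c.
- by apply: within_contM => //; have [] := C1_cst A c.
- exact: is_deriveZ (df i x Ox).
Qed.

Lemma C1_sum A (F : 'I_3 -> E -> R) F' : (forall j, C1 A (F j) (F' j)) ->
  C1 A (fun x => \sum_(j < 3) F j x) (fun i x => \sum_(j < 3) F' j i x).
Proof.
move=> h; have := C1D (C1D (h 0) (h 1)) (h 2); congr C1.
- by apply/funext => x; rewrite sum3.
- by apply/funext => i; apply/funext => x; rewrite sum3.
Qed.

Lemma derive_cont (g : R -> R) (t d : R) : is_derive t (1 : R) g d -> {for t, continuous g}.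
Proof. by move=> [h _]; apply/differentiable_continuous/derivable1_diffP. Qed.

Lemma C1_comp (g g' : R -> R) f f' : C1 (@Omega R) f f' ->
  (forall x, Omega x -> is_derive (f x) (1 : R) g (g' (f x))) ->
  (forall x, Omega x -> {for f x, continuous g'}) ->
  C1 (@Omega R) (fun x => g (f x)) (fun i x => g' (f x) * f' i x).
Proof.
move=> [cf cf' df] dg cg'; have O := @Omega_open R.
have cfx x : Omega x -> {for x, continuous f} := within_Omega_cont cf.
split=> [|i|i x Ox].
- rewrite continuous_open_subspace // => x /set_mem Ox.
  apply: (@continuous_comp _ _ _ f g); first exact: cfx.
  by have := dg _ Ox; exact: derive_cont.
- apply: within_contM => //.
  rewrite continuous_open_subspace // => x /set_mem Ox.
  by apply: (@continuous_comp _ _ _ f g'); [exact: cfx|exact: cg'].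
- by apply: is_derive_comp1; [exact: dg|exact: df].
Qed.

(** Confined to the open ball, where positivity is known; for a general exponent the power is not
    C^1 at 0. *)
Lemma C1_powR (a : R) f f' : C1 (@Omega R) f f' -> (forall x, Omega x -> 0 < f x) ->
  C1 (@Omega R) (fun x => f x `^ a) (fun i x => a * f x `^ (a - 1) * f' i x).
Proof.
move=> hf f0.
have H := @C1_comp (fun t : R => t `^ a) (fun t : R => a * t `^ (a - 1)) f f' hf.
apply: H => x /f0 fx0.
  exact: is_derive1_powR.
apply: cvgM; first exact: cvg_cst.
by have := is_derive1_powR (a - 1) fx0; exact: derive_cont.
Qed.

Lemma sqnorm_line (c : R) i x :
  sqnorm (c *: evec R i + x) = sqnorm x + 2 * c * x 0 i + c ^+ 2.
Proof.
move: i; rewrite /sqnorm /evec.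
by apply: ord3_ind; rewrite !mxE /=; ring.
Qed.

(* The exit point lies on the line through [x] parallel to an axis along which
   [x] has a large coordinate. *)
Lemma exit_line x i : Omega x -> 1 / 16 <= x 0 i ^+ 2 ->
  exists c : R, [/\ Gamma (c *: evec R i + x), `|c| <= 2 * (1 - sqnorm x) &
    forall s, 0 < s < 1 -> Omega ((s * c) *: evec R i + x)].
Proof.
move=> /OmegaE Ox xi; set a := x 0 i in xi *; set S := sqnorm x in Ox *.
(* The positive root of t^2 + 2 t |a| = 1 - S, the distance to the sphere in the direction of the
   sign of [a]. As 2 |a| >= 1/2, it is at most 2 (1 - S). *)
pose t := Num.sqrt (a ^+ 2 + (1 - S)) - `|a|.
have a2 : `|a| ^+ 2 = a ^+ 2 by rewrite real_normK ?num_real.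
have a4 : 1 / 4 <= `|a| by have := normr_ge0 a; nra.
have q2 : Num.sqrt (a ^+ 2 + (1 - S)) ^+ 2 = a ^+ 2 + (1 - S).
  by rewrite sqr_sqrtr; nra.
have t0 : 0 < t by rewrite /t; have := sqrtr_ge0 (a ^+ 2 + (1 - S)); nra.
have tE : t ^+ 2 + 2 * t * `|a| = 1 - S.
  by rewrite /t; move: q2; nra.
have t_le : t <= 2 * (1 - S) by nra.
exists (t * Num.sg a).
have ac : Num.sg a * a = `|a| by rewrite -normrEsg.
have c2 : (Num.sg a) ^+ 2 = 1.
  by rewrite sqr_sg; have -> : a != 0 by apply/eqP => a0; move: xi; rewrite a0; lra.
split.
- apply/GammaE; rewrite sqnorm_line -/a -/S exprMn c2.
  by rewrite -!mulrA ac; lra.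
- by rewrite normrM gtr0_norm // normr_sg; case: (a != 0); rewrite ?mulr1 ?mulr0 //; lra.
- move=> s /andP[s0 s1]; apply/OmegaE; rewrite sqnorm_line -/a -/S !exprMn c2.
  rewrite -!mulrA ac mulr1.
  have : s ^+ 2 * t ^+ 2 + 2 * s * t * `|a| < t ^+ 2 + 2 * t * `|a|; last lra.
  have h1 : 0 < t * `|a| by apply: mulr_gt0 => //; lra.
  have h2 : 0 < t ^+ 2 by rewrite exprn_gt0.
  have s2 : s ^+ 2 < 1 by rewrite expr_lt1 // ltW.
  have k1 : 0 < (1 - s) * (t * `|a|) by rewrite mulr_gt0 // subr_gt0.
  have k2 : 0 < (1 - s ^+ 2) * t ^+ 2 by rewrite mulr_gt0 // subr_gt0.
  by lra.
Qed.

(** If some coordinate is at least 1/4 in absolute value, the mean value theorem on the exit segment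
    gives the term [2 * M']. Otherwise |x|^2 <= 3/16, and 1 - |x|^2 >= 13/16 lets [2 * M] absorb the
    supremum of |f|. *)
Lemma C1_boundary_bound f f' : C1 (@Omega_bar R) f f' ->
  (forall x, Gamma x -> f x = 0) ->
  exists2 M, 0 < M & forall x, Omega x -> `|f x| <= M * (1 - sqnorm x).
Proof.
move=> [cf cf' df] f0.
have [M M0 hM] := within_bounded cf.
have [M' M'0 hM'] : exists2 M', 0 < M' & forall i x, Omega_bar x -> `|f' i x| <= M'.
  have [m0 p0 h0] := within_bounded (cf' 0).
  have [m1 p1 h1] := within_bounded (cf' 1).
  have [m2 p2 h2] := within_bounded (cf' 2).
  exists (m0 + m1 + m2); first lra.
  move=> i x Ox; move: i; apply: ord3_ind.
  - by have := h0 x Ox; lra.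
  - by have := h1 x Ox; lra.
  - by have := h2 x Ox; lra.
exists (2 * M + 2 * M'); first lra.
move=> x Ox; have /OmegaE S1 := Ox.
have big i : 1 / 16 <= x 0 i ^+ 2 -> `|f x| <= (2 * M + 2 * M') * (1 - sqnorm x).
  move=> /(exit_line Ox) [c [Gc c_le hc]].
  have [] := @mvt_line R f (f' i) x (evec R i) c.
  - by move=> s s01; apply: df; exact: hc.
  - apply: (within_cont_comp _ _ cf); first exact: line_continuous.
    move=> s /=; rewrite in_itv /= => /andP[s0 s1].
    have [->|sn0] := eqVneq s 0; first by rewrite mul0r scale0r add0r; exact: Omega_sub_bar.
    have [->|sn1] := eqVneq s 1; first by rewrite mul1r; exact: Gamma_sub_bar.
    by apply/Omega_sub_bar/hc; rewrite !lt_neqAle eq_sym sn0 s0 sn1 s1.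
  - move=> s s01; rewrite (f0 _ Gc) sub0r => e.
    have -> : `|f x| = `|c| * `|f' i ((s * c) *: evec R i + x)| by rewrite -normrM -e normrN.
    apply: le_trans (_ : 2 * (1 - sqnorm x) * M' <= _); last nra.
    by apply: ler_pM => //; apply: hM'; apply/Omega_sub_bar/hc.
have [/big//|H0] := boolP (1 / 16 <= x 0 0 ^+ 2).
have [/big//|H1] := boolP (1 / 16 <= x 0 1 ^+ 2).
have [/big//|H2] := boolP (1 / 16 <= x 0 2 ^+ 2).
rewrite -!ltNge in H0 H1 H2; have := hM x (Omega_sub_bar Ox).
have : sqnorm x <= 3 / 16 by rewrite /sqnorm; lra.
by nra.
Qed.

(** The path from 0 to [x] follows the three axes in turn; it stays in the ball because no
    coordinate ever exceeds that of [x] in absolute value. *)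
Lemma C1_const f f' : C1 (@Omega R) f f' -> (forall i x, Omega x -> f' i x = 0) ->
  forall x, Omega x -> f x = f 0.
Proof.
move=> [_ _ df] f'0 x /OmegaE; rewrite /sqnorm => Sx.
have step i y : (forall s, 0 <= s <= 1 -> Omega ((s * x 0 i) *: evec R i + y)) ->
    f (x 0 i *: evec R i + y) = f y.
  move=> hs; apply/eqP; rewrite -subr_eq0; apply/eqP.
  have [|s s01 ->] := @mvt_segment R f (f' i) y (evec R i) (x 0 i).
    by move=> s s01; apply: df; exact: hs.
  by rewrite f'0 ?mulr0 //; exact: hs.
have q (s a : R) : 0 <= s <= 1 -> (s * a) ^+ 2 <= a ^+ 2.
  move=> /andP[s0 s1]; rewrite exprMn -[leRHS]mul1r ler_wpM2r ?sqr_ge0 //.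
  by rewrite expr_le1.
have h0 := sqr_ge0 (x 0 0); have h1 := sqr_ge0 (x 0 1); have h2 := sqr_ge0 (x 0 2).
have v0 c : c *: evec R 0 + 0 = vec3 c 0 0 by apply: rowP3; rewrite !mxE /=; ring.
have v1 c a : c *: evec R 1 + vec3 a 0 0 = vec3 a c 0 by apply: rowP3; rewrite !mxE /=; ring.
have v2 c a b : c *: evec R 2 + vec3 a b 0 = vec3 a b c by apply: rowP3; rewrite !mxE /=; ring.
have e0 : f (vec3 (x 0 0) 0 0) = f 0.
  rewrite -v0; apply: step => s /(q s (x 0 0)) hs; rewrite v0.
  by apply/OmegaE; rewrite /sqnorm !vec3E; lra.
have e1 : f (vec3 (x 0 0) (x 0 1) 0) = f 0.
  rewrite -v1 step // => s /(q s (x 0 1)) hs; rewrite v1.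
  by apply/OmegaE; rewrite /sqnorm !vec3E; lra.
have e2 : f (vec3 (x 0 0) (x 0 1) (x 0 2)) = f 0.
  rewrite -v2 step // => s /(q s (x 0 2)) hs; rewrite v2.
  by apply/OmegaE; rewrite /sqnorm !vec3E; lra.
by rewrite -e2; congr f; apply: rowP3; rewrite !vec3E.
Qed.

End C1.

(** * The cutoff argument *)


Section Cutoff.
Variable R : realType.
Notation E := 'rV[R]_3.
Implicit Types (x y p : E) (A : set E).

Lemma C1_ext A (f g : E -> R) f' g' : C1 A f f' ->
  (forall x, f x = g x) -> (forall i x, f' i x = g' i x) -> C1 A g g'.
Proof.
move=> h e e'; have -> : g = f by apply/funext.
by have -> : g' = f' by apply/funext => i; apply/funext.
Qed.

Lemma C1_sqnorm A : C1 A (@sqnorm R) (fun i x => 2 * x 0 i).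
Proof.
have h j := C1M (@C1_coord R A j) (@C1_coord R A j).
apply: C1_ext (C1D (C1D (h 0) (h 1)) (h 2)) _ _.
- by move=> x; rewrite /sqnorm !expr2.
- by move=> i x; move: i; apply: ord3_ind; rewrite /=; ring.
Qed.

Definition pos_sqr (t : R) : R := Num.max t 0 ^+ 2.

Lemma pos_sqr_ge (t : R) : 0 <= t -> pos_sqr t = t ^+ 2.
Proof. by move=> t0; rewrite /pos_sqr max_l. Qed.

Lemma pos_sqr_le (t : R) : t <= 0 -> pos_sqr t = 0.
Proof. by move=> t0; rewrite /pos_sqr max_r // expr0n. Qed.

Lemma max0_continuous : continuous (fun t : R => Num.max t 0).
Proof.
move=> t; apply: (@continuous_max R R idfun (cst 0)).
  exact: cvg_id.
exact: cvg_cst.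
Qed.

Lemma is_derive_pos_sqr (t : R) : is_derive t (1 : R) pos_sqr (2 * Num.max t 0).
Proof.
have [t0|t0|->] := ltgtP t 0.
- rewrite mulr0; apply: (@near_eq_is_derive _ _ _ (cst 0)).
    have : \forall s \near t, s < 0 by exact: lt_nbhsl.
    by apply: filterS => s s0; rewrite pos_sqr_le // ltW.
- apply: (@near_eq_is_derive _ _ _ (fun s : R => s ^+ 2)).
    have : \forall s \near t, 0 < s by exact: lt_nbhsr.
    by apply: filterS => s s0; rewrite pos_sqr_ge // ltW.
  have h := @is_deriveX _ _ (@id R) 2 t 1 1 (is_derive_id _ _).
  by apply: (is_derive_eq h); rewrite /= expr1; exact: mulr1.
(* At 0 the difference quotient of [pos_sqr] is max(t, 0) itself, which is continuous and vanishes
   at 0. *)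
- apply/is_derive1_caratheodory; exists (fun t => Num.max t 0); split.
  + move=> z; rewrite [pos_sqr 0]pos_sqr_le // !subr0 /pos_sqr expr2.
    by case: (leP z 0) => z0; rewrite ?mul0r.
  + exact: max0_continuous.
  + by rewrite maxxx mulr0.
Qed.

(* [(1 - s) * |d/ds profile| <= 2 e], yet [profile] has compact support in
   [s < 1] and tends to [1] as [e] goes to [0]. *)
Definition profile (e : R) x := pos_sqr (1 + e * ln (1 - sqnorm x)).

Definition profile' (e : R) (i : 'I_3) x :=
  2 * Num.max (1 + e * ln (1 - sqnorm x)) 0 * (e * ((1 - sqnorm x)^-1 * (- (2 * x 0 i)))).

Lemma C1_profile e : C1 (@Omega R) (profile e) (profile' e).
Proof.
apply: (@C1_comp R pos_sqr (fun t => 2 * Num.max t 0)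
  (fun x => 1 + e * ln (1 - sqnorm x))
  (fun i x => e * ((1 - sqnorm x)^-1 * (- (2 * x 0 i))))); last 2 first.
- by move=> x _; exact: is_derive_pos_sqr.
- by move=> x _; apply: cvgM; [exact: cvg_cst|exact: max0_continuous].
have h1 : C1 (@Omega R) (fun x => 1 - sqnorm x) (fun i x => - (2 * x 0 i)).
  apply: C1_ext (C1D (C1_cst _ 1) (C1Z (-1) (C1_sqnorm _))) _ _.
    by move=> x; rewrite mulN1r.
  by move=> i x /=; rewrite mulN1r add0r.
have h2 : C1 (@Omega R) (fun x => ln (1 - sqnorm x))
    (fun i x => (1 - sqnorm x)^-1 * (- (2 * x 0 i))).
  apply: (@C1_comp R (@ln R) (@GRing.inv R) _ _ h1) => x /OmegaE Ox.
    by apply: is_derive1_ln; rewrite subr_gt0.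
  by apply: inv_continuous; rewrite gt_eqF // subr_gt0.
apply: C1_ext (C1D (C1_cst _ 1) (C1Z e h2)) _ _ => //.
by move=> i x /=; rewrite add0r.
Qed.

Lemma profile_support e x : 0 < e -> Omega x -> 1 - expR (- e^-1) < sqnorm x ->
  profile e x = 0 /\ forall i, profile' e i x = 0.
Proof.
move=> e0 /OmegaE Ox sx.
have L : 1 + e * ln (1 - sqnorm x) <= 0.
  have h : ln (1 - sqnorm x) <= - e^-1.
    rewrite -[leRHS]expRK ler_ln ?posrE ?expR_gt0 ?subr_gt0 //; lra.
  have := ler_wpM2l (ltW e0) h; rewrite mulrN mulfV ?gt_eqF //; lra.
split; first by rewrite /profile pos_sqr_le.
by move=> i; rewrite /profile' max_r // mulr0 mul0r.
Qed.

(** The first bound keeps the cutoff above 1/4 near the chosen point; the second makes the total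
    error smaller than the gain [c] there. *)
Lemma small_parameter (c M L : R) : 0 < c -> 0 < M -> 0 <= L ->
  exists2 e, 0 < e & e * L <= 1 / 2 /\ 8 * (4 * e * M) < c.
Proof.
move=> c0 M0 L0; exists (c / (64 * M + 2 * c * L)).
  by apply: divr_gt0; nra.
have D : 0 < 64 * M + 2 * c * L by nra.
split; first by rewrite mulrAC ler_pdivrMr //; nra.
rewrite (_ : 8 * _ = 32 * M * c / (64 * M + 2 * c * L)); last by ring.
by rewrite ltr_pdivrMr //; nra.
Qed.

Variables (F : 'I_3 -> E -> R) (F' : 'I_3 -> 'I_3 -> E -> R).
Hypothesis C1F : forall i, C1 (@Omega R) (F i) (F' i).

(** The case distinction is essential: beyond the ball [ln] returns a default value and [F] is
    unconstrained. *)
Let G e i x := if sqnorm x < 1 then profile e x * F i x else 0.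
Let H e i x := if sqnorm x < 1 then
  profile e x * F' i i x + F i x * profile' e i x else 0.

(** The cutoff is already 0 on the shell 1 - exp(-1/e) < |x|^2 < 1, so extension by zero is locally
    trivial across the sphere and [G] is C^1 on the whole space. *)
Lemma near_cutoff e x : 0 < e -> ~ Omega x ->
  \forall y \near x, (forall i, G e i y = 0) /\ (forall i, H e i y = 0).
Proof.
move=> e0 Ox.
have sx : 1 <= sqnorm x by rewrite leNgt; apply/negP => /OmegaE.
have : \forall y \near x, 1 - expR (- e^-1) < sqnorm y.
  apply: (@sqnorm_continuous R x [set s | 1 - expR (- e^-1) < s]); apply: lt_nbhsr.
  by apply: lt_le_trans sx; rewrite ltrBlDr ltrDl expR_gt0.
apply: filterS => y sy; rewrite /G /H; split => i; case: ifP => // /OmegaE Oy.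
  by have [-> _] := profile_support e0 Oy sy; rewrite mul0r.
by have [-> ->] := profile_support e0 Oy sy; rewrite mul0r mulr0 addr0.
Qed.

Lemma is_derive_cutoff e i x : 0 < e -> is_derive x (evec R i) (G e i) (H e i x).
Proof.
move=> e0; have [Ox|Ox] := pselect (Omega x).
  have [_ _ d] := C1M (C1_profile e) (C1F i).
  have := d i x Ox; have /OmegaE := Ox; rewrite /H => ->.
  apply: near_eq_is_derive; have := near_Omega Ox.
  by apply: filterS => y /OmegaE; rewrite /G => ->.
have N := near_cutoff e0 Ox.
have [_ ->] := nbhs_singleton N.
apply: (@near_eq_is_derive _ _ _ (cst 0)).
by apply: filterS N => y [-> _].
Qed.

Lemma continuous_cutoff e i : 0 < e -> continuous (H e i).
Proof.
move=> e0 x; have [Ox|Ox] := pselect (Omega x).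
  have [_ c _] := C1M (C1_profile e) (C1F i).
  have cx := within_Omega_cont (c i) Ox.
  rewrite /continuous_at; have -> : H e i x = profile e x * F' i i x + F i x * profile' e i x.
    by have /OmegaE := Ox; rewrite /H => ->.
  have K : \forall y \near x, profile e y * F' i i y + F i y * profile' e i y = H e i y.
    by apply: filterS (near_Omega Ox) => y /OmegaE; rewrite /H => ->.
  exact: cvg_trans (near_eq_cvg K) cx.
have N := near_cutoff e0 Ox.
rewrite /continuous_at; have [_ ->] := nbhs_singleton N.
have K : \forall y \near x, cst 0 y = H e i y by apply: filterS N => y [_ ->].
exact: cvg_trans (near_eq_cvg K) (@cvg_cst _ (0 : R) _ (nbhs x) _).
Qed.

Variable M : R.
Hypothesis M_gt0 : 0 < M.
Hypothesis F_normal : forall x, Omega x -> `|\sum_(i < 3) F i x * x 0 i| <= M * (1 - sqnorm x).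
Hypothesis div_ge0 : forall x, Omega x -> 0 <= \sum_(i < 3) F' i i x.

(** The gradient of the cutoff is radial, so it meets only F.x and contributes -4 e m F.x / (1 -
    |x|^2) with 0 <= m <= 1; the quotient is bounded by [M]. *)
Lemma cutoff_div_ge e x : 0 < e -> Omega x ->
  profile e x * (\sum_(i < 3) F' i i x) - 4 * e * M <= \sum_(i < 3) H e i x.
Proof.
move=> e0 Ox; have /OmegaE s1 := Ox.
have := F_normal Ox; rewrite /H s1 !sum3 /profile'.
set m := Num.max _ 0; set r := (1 - sqnorm x)^-1 => hF.
have m0 : 0 <= m by rewrite le_max lexx orbT.
have m1 : m <= 1.
  rewrite ge_max ler01 andbT gerDl mulr_ge0_le0 ?(ltW e0) // ln_le0 // gerBl.
  exact: sqnorm_ge0.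
set D := F 0 x * _ + _ + _ in hF.
have rD : `|r * D| <= M.
  have r0 : 0 < 1 - sqnorm x by rewrite subr_gt0.
  by rewrite normrM /r normfV (gtr0_norm r0) mulrC ler_pdivrMr.
have : `|m * (r * D)| <= M.
  rewrite normrM ger0_norm //; apply: le_trans rD.
  by rewrite ler_piMl.
move=> /(ler_wpM2l (ltW e0)) => h.
have h2 : - (e * M) <= - (e * (m * (r * D))).
  rewrite lerN2; apply: le_trans h; rewrite ler_wpM2l ?(ltW e0) //; exact: ler_norm.
have -> : profile e x * F' 0 0 x + F 0 x * (2 * m * (e * (r * - (2 * x 0 0)))) +
  (profile e x * F' 1 1 x + F 1 x * (2 * m * (e * (r * - (2 * x 0 1))))) +
  (profile e x * F' 2 2 x + F 2 x * (2 * m * (e * (r * - (2 * x 0 2))))) =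
  profile e x * (F' 0 0 x + F' 1 1 x + F' 2 2 x) - 4 * (e * (m * (r * D))).
  by rewrite /D; ring.
by lra.
Qed.

Lemma profile_ge0 e x : 0 <= profile e x.
Proof. by rewrite /profile /pos_sqr sqr_ge0. Qed.

(** If the divergence were [c1 > 0] at a point, it would exceed [c1 / 2] on a cube around it, where
    the cutoff is at least 1/4. The cut-off field then has divergence at least c1/8 - 4 e M on the
    cube and at least -4 e M elsewhere, against [divergence_box_le] for small [e]. *)
Lemma divergence_eq0 x : Omega x -> \sum_(i < 3) F' i i x = 0.
Proof.
move=> Ox0; apply/eqP; rewrite eq_le div_ge0 // andbT leNgt; apply/negP.
set q := fun x => \sum_(i < 3) F' i i x; rewrite -[X in 0 < X]/(q x).
move: x Ox0 => x0 Ox0; set c1 := q x0 => c1_gt0.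
(* A level strictly between |x0|^2 and 1: below it the logarithm is bounded by a constant chosen
   before [e]. *)
have /OmegaE S1 := Ox0; pose s1 := (1 + sqnorm x0) / 2.
have s1_lt1 : s1 < 1 by rewrite /s1; lra.
have qc : {for x0, continuous q}.
  have c i : {for x0, continuous (F' i i)}.
    by have [_ c _] := C1F i; exact: within_Omega_cont (c i) Ox0.
  have -> : q = fun x => F' 0 0 x + F' 1 1 x + F' 2 2 x.
    by apply/funext => x; rewrite /q sum3.
  exact: (cvgD (cvgD (c 0) (c 1)) (c 2)).
have N1 : \forall y \near x0, c1 / 2 < q y by apply: (qc [set s | c1 / 2 < s]); apply: lt_nbhsr; rewrite -/c1; lra.
have N2 : \forall y \near x0, sqnorm y < s1.
  by apply: (@sqnorm_continuous R x0 [set s | s < s1]); apply: lt_nbhsl; rewrite /s1; lra.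
have N12 : \forall y \near x0, c1 / 2 < q y /\ sqnorm y < s1 by apply: filterI N1 N2.
move: N12 => /nbhs_normP [r /= r0 hr].
pose l := r / 2; have l0 : 0 < l by rewrite /l; lra.
have box y : (forall i, `|y 0 i - x0 0 i| <= l) -> c1 / 2 < q y /\ sqnorm y < s1.
  move=> hy; apply: hr => /=; apply: (@le_lt_trans _ _ l); last by rewrite /l; lra.
  apply: mx_norm_le; first exact: ltW.
  by move=> i; rewrite !mxE distrC; exact: hy.
(* Applied with c = l and c = -l, this places the box inside the lattice cube. *)
have boxe (c : R) i : `|c| <= l -> (x0 0 i + c) ^+ 2 < 1.
  move=> hc; have [|_ h] := box (c *: evec R i + x0).
    move=> j; rewrite !mxE addrK normrM; case: (_ && _); rewrite ?normr1 ?normr0 ?mulr1 ?mulr0 //.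
    exact: ltW.
  have := sqr_coord_le (c *: evec R i + x0) i; rewrite !mxE !eqxx /= mulr1 addrC.
  by lra.
pose L := - ln (1 - s1).
have L0 : 0 <= L.
  by rewrite /L oppr_ge0 ln_le0 // gerBl /s1; have := sqnorm_ge0 x0; lra.
have cl : 0 < c1 / 8 * l ^+ 3 by rewrite mulr_gt0 ?exprn_gt0 // divr_gt0.
have [e e0 [e1 e2]] := small_parameter cl M_gt0 L0.
have quarter y : sqnorm y < s1 -> 1 / 4 <= profile e y.
  move=> ys; have hl : ln (1 - s1) <= ln (1 - sqnorm y).
    by rewrite ler_ln ?posrE ?subr_gt0; lra.
  have := ler_wpM2l (ltW e0) hl; rewrite /L mulrN in e1 => hl2.
  rewrite /profile pos_sqr_ge; first by nra.
  by lra.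
have := @divergence_box_le R (G e) (H e) x0 l (c1 / 8) (4 * e * M)
  (fun i x => @is_derive_cutoff e i x e0) (fun i => @continuous_cutoff e i e0).
have d0 : 0 < 4 * e * M by rewrite !mulr_gt0.
move=> /(_ _ l0) h.
suff : c1 / 8 * l ^+ 3 <= 8 * (4 * e * M) by rewrite leNgt e2.
apply: h => //.
- by move=> i x Ox; rewrite /G; case: ifP => // /OmegaE.
- move=> i; have := @boxe (- l) i; rewrite normrN gtr0_norm // => /(_ (lexx _)).
  by nra.
- move=> i; have := @boxe l i; rewrite gtr0_norm // => /(_ (lexx _)).
  by nra.
- lra.
- move=> x _; have [Ox|Ox] := pselect (Omega x).
    apply: le_trans (cutoff_div_ge e0 Ox).
    by have := mulr_ge0 (profile_ge0 e x) (div_ge0 Ox); lra.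
  rewrite big1; first lra.
  by move=> i _; rewrite /H; case: ifP => // /OmegaE.
- move=> x /box [hq hs].
  have Ox : Omega x by apply/OmegaE; lra.
  apply: le_trans (cutoff_div_ge e0 Ox); rewrite -/(q x).
  have := quarter x hs; nra.
Qed.

End Cutoff.

(** * Fields with skew gradient are affine *)


Section Rigid.
Variable R : realType.
Notation E := 'rV[R]_3.
Implicit Types (x y p : E) (A : set E).

Lemma C1_partial A (f : E -> R) f' i x : C1 A f f' -> Omega x -> partial i f x = f' i x.
Proof. by move=> [_ _ d] Ox; have [_ h] := d i x Ox. Qed.

Lemma C1_partial_eq A (f g : E -> R) f' i x : C1 A f f' ->
  (forall y, Omega y -> g y = f y) -> Omega x -> partial i g x = f' i x.
Proof.
move=> hf fg Ox; rewrite -(C1_partial i hf Ox); apply: near_eq_derive.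
by apply: filterS (near_Omega Ox) => y /fg.
Qed.

(** Two mean value theorems, first along [i] for the increment of [f] along [j], then along [j]. The
    left-hand side is symmetric in [i] and [j], which is what [schwarz] exploits. *)
Lemma second_difference (f : E -> R) f' (f'' : 'I_3 -> 'I_3 -> E -> R) i j x (h : R) :
  C1 (@Omega R) f f' -> (forall i, C1 (@Omega R) (f' i) (f'' i)) ->
  (forall s t, 0 <= s <= 1 -> 0 <= t <= 1 ->
    Omega ((t * h) *: evec R j + ((s * h) *: evec R i + x))) ->
  exists s t, [/\ 0 <= s <= 1, 0 <= t <= 1 &
    f (h *: evec R j + (h *: evec R i + x)) - f (h *: evec R i + x)
      - f (h *: evec R j + x) + f x
    = h ^+ 2 * f'' i j ((t * h) *: evec R j + ((s * h) *: evec R i + x))].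
Proof.
move=> [_ _ df] c' O.
pose g y := f (h *: evec R j + y) - f y.
pose g' y := f' i (h *: evec R j + y) - f' i y.
have [s s01 es] : exists2 s, 0 <= s <= 1 &
    g (h *: evec R i + x) - g x = h * g' ((s * h) *: evec R i + x).
  apply: mvt_segment => s s01; apply/is_derive_line.
  have -> : (fun t : R => g (t *: evec R i + x)) =
      (fun t => f (t *: evec R i + (h *: evec R j + x))) - (fun t => f (t *: evec R i + x)).
    by apply/funext => t; rewrite /g addrCA.
  apply: is_deriveB.
  - apply/is_derive_line; rewrite addrCA; apply: df.
    by have := O s 1 s01; rewrite mul1r; apply; rewrite ler01 lexx.
  - apply/is_derive_line; apply: df.
    by have := O s 0 s01; rewrite mul0r scale0r add0r; apply; rewrite ler01 lexx.
have [t t01 et] : exists2 t, 0 <= t <= 1 &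
    f' i (h *: evec R j + ((s * h) *: evec R i + x)) - f' i ((s * h) *: evec R i + x) =
    h * f'' i j ((t * h) *: evec R j + ((s * h) *: evec R i + x)).
  apply: mvt_segment => t t01; have [_ _ d] := c' i; apply: d; exact: O.
exists s, t; split => //.
rewrite expr2 -mulrA -et -/(g' _) -es /g.
by ring.
Qed.

Lemma schwarz (f : E -> R) f' (f'' : 'I_3 -> 'I_3 -> E -> R) i j x :
  C1 (@Omega R) f f' -> (forall i, C1 (@Omega R) (f' i) (f'' i)) ->
  Omega x -> f'' i j x = f'' j i x.
Proof.
move=> cf cf' Ox.
have cont k l : {for x, continuous (f'' k l)}.
  by have [_ c _] := cf' k; exact: within_Omega_cont (c l) Ox.
apply/eqP; rewrite -subr_eq0 -normr_le0; apply/ler_addgt0Pl => e e0; rewrite addr0.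
have e20 : 0 < e / 2 by rewrite divr_gt0.
have N k l : \forall y \near x, `|f'' k l x - f'' k l y| < e / 2.
  by have /cvgr_dist_lt := cont k l; apply.
have : \forall y \near x, Omega y /\ (`|f'' i j x - f'' i j y| < e / 2 /\
    `|f'' j i x - f'' j i y| < e / 2).
  by near=> y; split; [|split]; near: y; [exact: near_Omega|exact: N|exact: N].
move=> /nbhs_normP [r /= r0 hr].
(* Two displacements of length at most [r / 3] remain strictly inside the ball of radius [r]. *)
pose h := r / 3; have h0 : 0 < h by rewrite divr_gt0.
have inb k l s t : 0 <= s <= 1 -> 0 <= t <= 1 ->
    ball_ Num.Def.normr x r ((t * h) *: evec R k + ((s * h) *: evec R l + x)).
  move=> /andP[s0 s1] /andP[t0 t1] /=; rewrite addrA distrC addrK.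
  have b (q : R) m : 0 <= q -> q <= 1 -> `|(q * h) *: evec R m| <= h.
    move=> q0 q1; apply: mx_norm_le; first exact: ltW.
    move=> n; rewrite !mxE normrM ger0_norm; last by rewrite mulr_ge0 // ltW.
    have : q * h <= h by rewrite ler_piMl // ltW.
    have : 0 <= q * h by rewrite mulr_ge0 // ltW.
    by case: (_ && _); rewrite ?normr1 ?normr0 ?mulr1 ?mulr0 // => _ _; exact: ltW.
  apply: le_lt_trans (ler_normD _ _) _.
  have := b t k t0 t1; have := b s l s0 s1; rewrite /h in h0 *; lra.
have [|s [t [s01 t01 e1]]] := @second_difference f f' f'' i j x h cf cf'.
  by move=> s t s01 t01; case: (hr _ (inb j i s t s01 t01)).
have [|s' [t' [s'01 t'01 e2]]] := @second_difference f f' f'' j i x h cf cf'.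
  by move=> s1 t1 p1 q1; case: (hr _ (inb i j s1 t1 p1 q1)).
have [_ [b1 _]] := hr _ (inb j i s t s01 t01).
have [_ [_ b2]] := hr _ (inb i j s' t' s'01 t'01).
have E12 : f'' i j ((t * h) *: evec R j + ((s * h) *: evec R i + x)) =
   f'' j i ((t' * h) *: evec R i + ((s' * h) *: evec R j + x)).
  have h2 : h ^+ 2 != 0 by rewrite expf_neq0 // gt_eqF.
  by apply: (mulfI h2); rewrite -e1 -e2 addrCA; ring.
rewrite E12 in b1.
by move: b1 b2; rewrite !ltr_norml ler_norml => /andP[? ?] /andP[? ?]; lra.
Unshelve. all: by end_near.
Qed.

Lemma killing_affine (u : 'I_3 -> E -> R) (a : 'I_3 -> 'I_3 -> E -> R)
    (b : 'I_3 -> 'I_3 -> 'I_3 -> E -> R) :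
  (forall i, C1 (@Omega R) (u i) (a i)) ->
  (forall i j, C1 (@Omega R) (a i j) (b i j)) ->
  (forall i j x, Omega x -> a i j x + a j i x = 0) ->
  [/\ forall i j k x, Omega x -> b i j k x = 0,
    forall i j x, Omega x -> a i j x = a i j 0 &
    forall i x, Omega x -> u i x = u i 0 + \sum_(j < 3) a i j 0 * x 0 j].
Proof.
move=> cu ca skew.
have bs i j k x : Omega x -> b i j k x = b i k j x.
  by move=> Ox; exact: (@schwarz (u i) (a i) (b i) j k x (cu i) (ca i) Ox).
have ba i j k x : Omega x -> b i j k x = - b j i k x.
  move=> Ox; have h := C1D (ca i j) (ca j i).
  have := C1_partial k h Ox; rewrite (@C1_partial_eq _ _ _ _ k x (C1_cst (@Omega R) 0)) //.
    by move/esym/eqP; rewrite addr_eq0 => /eqP.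
  by move=> y Oy; exact: skew.
have b0 i j k x : Omega x -> b i j k x = 0.
  move=> Ox; have h : b i j k x = - b i j k x.
    (* Symmetry in the last two indices and antisymmetry in the first two alternate three times; the
       indices return to their places with the sign reversed. *)
    by rewrite {1}ba // bs // ba // opprK bs // ba // bs.
  by lra.
have a0 i j x : Omega x -> a i j x = a i j 0.
  by move=> Ox; apply: (C1_const (ca i j)) Ox => k y Oy; exact: b0.
split => // i x Ox.
have h := C1D (cu i) (C1Z (-1) (C1_sum (fun j => C1Z (a i j 0) (@C1_coord R (@Omega R) j)))).
have := C1_const h _ Ox => /= H.
suff : u i x + -1 * (\sum_(j < 3) a i j 0 * x 0 j) =
       u i 0 + -1 * (\sum_(j < 3) a i j 0 * (0 : E) 0 j).
  by rewrite [X in _ = _ + _ * X]big1; [lra|move=> j _; rewrite mxE mulr0].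
apply: H => k y Oy; rewrite a0 // (bigD1 k) //= eqxx big1.
  by rewrite addr0 mulr1 mulN1r subrr.
by move=> j /negbTE jk; rewrite eq_sym jk mulr0.
Qed.

End Rigid.

(** * The energy identity *)


Section Algebra.
Variables (R : realType).

(** Pointwise form of div(rho |u|^2/2 u) = u . div(rho u (x) u) - |u|^2/2 div(rho u), with [r] for
    grad rho and [a i j] for the [j]-th derivative of u_i. *)
Lemma kinetic_flux_identity (rho : R) (r u : 'I_3 -> R) (a : 'I_3 -> 'I_3 -> R) :
  \sum_(i < 3) (rho * (2^-1 * (\sum_(j < 3) u j * u j)) * a i i
    + u i * (rho * (2^-1 * (\sum_(j < 3) (u j * a j i + u j * a j i)))
             + 2^-1 * (\sum_(j < 3) u j * u j) * r i))
  = \sum_(i < 3) u i * (\sum_(j < 3) (rho * (u i * a j j + u j * a i j) + u i * u j * r j))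
    - 2^-1 * (\sum_(j < 3) u j * u j) * \sum_(i < 3) (rho * a i i + u i * r i).
Proof. by rewrite !sum3; field. Qed.

(** Pointwise form of div(S u) = u . div S + S : grad u; only the symmetric part of grad u survives
    against [S], hence the squares. *)
Lemma stress_flux_identity (mu lambda : R) (u : 'I_3 -> R) (a : 'I_3 -> 'I_3 -> R)
    (S : 'I_3 -> 'I_3 -> R) (S' : 'I_3 -> 'I_3 -> 'I_3 -> R) :
  (forall i j, S i j = mu * (a i j + a j i) + lambda * ((i == j)%:R * \sum_(k < 3) a k k)) ->
  \sum_(i < 3) \sum_(j < 3) (S j i * a j i + u j * S' j i i)
  = \sum_(i < 3) u i * (\sum_(j < 3) S' i j j)
    + (mu / 2 * (\sum_(i < 3) \sum_(j < 3) (a i j + a j i) ^+ 2)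
       + lambda * (\sum_(k < 3) a k k) ^+ 2).
Proof. by move=> e; rewrite !sum3 !e !sum3 /=; field. Qed.

End Algebra.

Section Energy.
Variable R : realType.
Notation E := 'rV[R]_3.
Implicit Types x y : E.
Variables (gamma mu lambda : R) (rho : E -> R) (u : E -> E).
Hypotheses (gamma_gt1 : 1 < gamma) (mu_gt0 : 0 < mu) (lambda_gt0 : 0 < lambda).
Hypothesis sol : stationary_solution gamma mu lambda rho u.
Hypothesis rho_gt0 : forall x, Omega x -> 0 < rho x.
Variables (r : 'I_3 -> E -> R) (a : 'I_3 -> 'I_3 -> E -> R)
  (b : 'I_3 -> 'I_3 -> 'I_3 -> E -> R).
Hypothesis C1rho : C1 (@Omega_bar R) rho r.
Hypothesis C1u : forall i, C1 (@Omega_bar R) (fun x => u x 0 i) (a i).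
Hypothesis C1a : forall i j, C1 (@Omega_bar R) (a i j) (b i j).

Let C1O f f' (h : C1 (@Omega_bar R) f f') : C1 (@Omega R) f f' :=
  C1W (@Omega_sub_bar R) h.

Lemma continuity_eq x : Omega x ->
  \sum_(i < 3) (rho x * a i i x + u x 0 i * r i x) = 0.
Proof.
move=> Ox; rewrite -[RHS](sol_continuity sol Ox) /div; apply: eq_bigr => i _.
apply/esym; apply: (C1_partial_eq i (C1O (C1M C1rho (C1u i)))) => // y Oy.
by rewrite mxE.
Qed.

(** Built from the extended derivatives, hence continuous up to the sphere, where [stress] itself
    would see values of [u] outside the ball. *)
Definition stress_entry i j x :=
  mu * (a i j x + a j i x) + lambda * ((i == j)%:R * \sum_(k < 3) a k k x).

Definition stress_entry' i j k x :=
  mu * (b i j k x + b j i k x) + lambda * ((i == j)%:R * \sum_(l < 3) b l l k x).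

Lemma C1_stress i j : C1 (@Omega_bar R) (stress_entry i j) (stress_entry' i j).
Proof.
apply: C1D; first by apply: C1Z; exact: C1D.
by apply: C1Z; apply: C1Z; exact: (C1_sum (fun k => C1a k k)).
Qed.

Lemma stressE i j x : Omega x -> stress mu lambda u x i j = stress_entry i j x.
Proof.
move=> Ox; rewrite /stress /stress_entry /div !mxE.
rewrite !(C1_partial _ (C1u _) Ox) mulr_natl; congr (_ + lambda * (_ *+ _)).
by apply: eq_bigr => k _; exact: C1_partial (C1u k) Ox.
Qed.

Lemma momentum_eq i x : Omega x ->
  \sum_(j < 3) (rho x * (u x 0 i * a j j x + u x 0 j * a i j x)
                + u x 0 i * u x 0 j * r j x)
    + gamma * rho x `^ (gamma - 1) * r i x
  = \sum_(j < 3) stress_entry' i j j x.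
Proof.
move=> Ox; have := congr1 (fun v : E => v 0 i) (sol_momentum sol Ox).
rewrite /divm /grad !mxE => h; rewrite [RHS](_ : _ =
    \sum_(j < 3) partial j (fun y => stress mu lambda u y i j) x); last first.
  apply: eq_bigr => j _; apply/esym.
  by apply: (C1_partial_eq j (C1O (C1_stress i j))) => // y Oy; exact: stressE.
rewrite -h; congr (_ + _).
  apply: eq_bigr => j _; apply/esym.
  apply: (C1_partial_eq j (C1O (C1M C1rho (C1M (C1u i) (C1u j))))) => // y Oy.
  by rewrite /tensor !mxE big_ord1 !mxE.
apply/esym; exact: C1_partial (C1_powR gamma (C1O C1rho) rho_gt0) Ox.
Qed.

Let head x := rho x * (2^-1 * \sum_(j < 3) u x 0 j * u x 0 j) +
  gamma / (gamma - 1) * rho x `^ gamma.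

Let flux i x := - 1 * (head x * u x 0 i) + \sum_(j < 3) stress_entry j i x * u x 0 j.

Let dissipation x :=
  mu / 2 * (\sum_(i < 3) \sum_(j < 3) (a i j x + a j i x) ^+ 2)
  + lambda * (\sum_(k < 3) a k k x) ^+ 2.

Let head' i x := rho x * (2^-1 * \sum_(j < 3) (u x 0 j * a j i x + u x 0 j * a j i x))
  + 2^-1 * (\sum_(j < 3) u x 0 j * u x 0 j) * r i x
  + gamma / (gamma - 1) * (gamma * rho x `^ (gamma - 1) * r i x).

Lemma C1_head : C1 (@Omega R) head head'.
Proof.
have u2 j := C1M (C1O (C1u j)) (C1O (C1u j)).
exact: C1D (C1M (C1O C1rho) (C1Z 2^-1 (C1_sum u2)))
  (C1Z _ (C1_powR gamma (C1O C1rho) rho_gt0)).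
Qed.

Let flux' i k x := - 1 * (head x * a i k x + u x 0 i * head' k x)
  + \sum_(j < 3) (stress_entry j i x * a j k x + u x 0 j * stress_entry' j i k x).

Lemma C1_flux i : C1 (@Omega R) (flux i) (flux' i).
Proof.
apply: C1D; first by apply: C1Z; exact: C1M C1_head (C1O (C1u i)).
by apply: (C1_sum (F := fun j x => stress_entry j i x * u x 0 j)) => j;
  exact: C1M (C1O (C1_stress j i)) (C1O (C1u j)).
Qed.

Lemma div_flux x : Omega x -> \sum_(i < 3) flux' i i x = dissipation x.
Proof.
move=> Ox; have rg0 := rho_gt0 Ox.
have C := continuity_eq Ox.
have K := kinetic_flux_identity (rho x) (r^~ x) (u x 0) (fun i j => a i j x).
have T := @stress_flux_identity R mu lambda (u x 0) (fun i j => a i j x)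
  (fun i j => stress_entry i j x) (fun i j k => stress_entry' i j k x) (fun _ _ => erefl).
rewrite /flux' big_split /= T /dissipation addrA; set Q := mu / 2 * _.
suff -> : \sum_(i < 3) -1 * (head x * a i i x + u x 0 i * head' i x) =
  - \sum_(i < 3) u x 0 i * (\sum_(j < 3) stress_entry' i j j x) by ring.
under [in RHS]eq_bigr => i _ do rewrite -momentum_eq // mulrDr.
rewrite big_split /=; rewrite C mulr0 subr0 in K; rewrite -K.
have g1 : gamma - 1 != 0 by rewrite subr_eq0 gt_eqF.
have P : rho x `^ gamma = rho x * rho x `^ (gamma - 1).
  by rewrite (mulr_powRB1 (ltW rg0) (lt_trans ltr01 gamma_gt1)).
rewrite /head /head' P; set p := rho x `^ (gamma - 1).
(* Pressure work and divergence of the enthalpy flux differ by exactly this multiple of the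
   continuity equation. *)
have Z : gamma / (gamma - 1) * p * (\sum_(i < 3) (rho x * a i i x + u x 0 i * r i x)) = 0.
  by rewrite C mulr0.
rewrite -[RHS]subr0 -[X in _ = _ - X]Z.
rewrite !sum3; clear Z P K T C; field.
exact: g1.
Qed.

Lemma flux_normal_bound : exists2 M, 0 < M &
  forall x, Omega x -> `|\sum_(i < 3) flux i x * x 0 i| <= M * (1 - sqnorm x).
Proof.
have ux := C1_sum (fun i => C1M (C1u i) (@C1_coord R (@Omega_bar R) i)).
have ux0 x : Gamma x -> \sum_(i < 3) u x 0 i * x 0 i = 0.
  by move=> Gx; exact: (sol_impermeable sol Gx).
have [M1 M1_gt0 h1] := C1_boundary_bound ux ux0.
have sux := C1_sum (fun i => C1M (C1_sum (fun j => C1M (C1_stress j i) (C1u j)))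
  (@C1_coord R (@Omega_bar R) i)).
have sux0 x : Gamma x ->
    \sum_(i < 3) (\sum_(j < 3) stress_entry j i x * u x 0 j) * x 0 i = 0.
  (* The tangential vector in the slip condition is the velocity itself. *)
  move=> Gx; rewrite -[RHS](sol_slip sol Gx (sol_impermeable sol Gx)) dotvE !mxE !sum3 !mxE.
  have tr i j : trace (fun y => stress mu lambda u y i j) x = stress_entry i j x.
    have [c _ _] := C1_stress i j.
    by apply: trace_cont c _ Gx => y Oy; exact: stressE.
  by rewrite !tr /normal; ring.
have [M2 M2_gt0 h2] := C1_boundary_bound sux sux0.
have [m m_gt0 hm] : exists2 m, 0 < m & forall x, Omega x -> `|head x| <= m.
  have [cr _ _] := C1rho; have [mr mr_gt0 hr] := within_bounded cr.
  have [cu _ _] := C1_sum (fun j => C1M (C1u j) (C1u j)).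
  have [m mu_ hu] := within_bounded cu.
  have gg : 0 < gamma / (gamma - 1) by rewrite divr_gt0 ?subr_gt0 // (lt_trans ltr01).
  exists (mr * (2^-1 * m) + gamma / (gamma - 1) * mr `^ gamma).
    apply: addr_gt0; first by apply: mulr_gt0 => //; apply: mulr_gt0; rewrite ?invr_gt0.
    by apply: mulr_gt0 => //; exact: powR_gt0.
  move=> x Ox; have Obx := Omega_sub_bar Ox; have rg0 := rho_gt0 Ox.
  have rle : rho x <= mr by apply: le_trans (hr x Obx); exact: ler_norm.
  apply: le_trans (ler_normD _ _) _; apply: lerD.
    rewrite normrM normrM; apply: ler_pM => //; first exact: hr.
    by rewrite gtr0_norm ?invr_gt0 // ler_wpM2l ?invr_ge0 //; exact: hu.
  rewrite normrM gtr0_norm // ler_wpM2l ?(ltW gg) // ger0_norm ?powR_ge0 //.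
  by apply: ge0_ler_powR; rewrite ?nnegrE ?(ltW rg0) ?(ltW mr_gt0) // (le_trans ler01) // ltW.
exists (m * M1 + M2); first by rewrite addr_gt0 // mulr_gt0.
move=> x Ox.
have -> : \sum_(i < 3) flux i x * x 0 i = - (head x * \sum_(i < 3) u x 0 i * x 0 i)
   + \sum_(i < 3) (\sum_(j < 3) stress_entry j i x * u x 0 j) * x 0 i.
  by rewrite /flux !sum3; ring.
apply: le_trans (ler_normD _ _) _; rewrite [leRHS]mulrDl; apply: lerD; last exact: h2.
rewrite normrN normrM -mulrA; apply: ler_pM => //; first exact: hm.
exact: h1.
Qed.

Lemma dissipation_ge0 x : 0 <= dissipation x.
Proof.
apply: addr_ge0; last by rewrite mulr_ge0 ?sqr_ge0 // ltW.
rewrite mulr_ge0 // ?divr_ge0 ?(ltW mu_gt0) //.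
by apply: sumr_ge0 => i _; apply: sumr_ge0 => j _; exact: sqr_ge0.
Qed.

Lemma strain_eq0 i j x : Omega x -> a i j x + a j i x = 0.
Proof.
move=> Ox; have [M M0 hM] := flux_normal_bound.
have := divergence_eq0 C1_flux M0 hM _ Ox.
rewrite div_flux // => H.
have {}H : dissipation x = 0.
  by apply: H => y Oy; rewrite div_flux //; exact: dissipation_ge0.
have S0 : \sum_(i < 3) \sum_(j < 3) (a i j x + a j i x) ^+ 2 = 0.
  have h1 : 0 <= \sum_(i < 3) \sum_(j < 3) (a i j x + a j i x) ^+ 2.
    by apply: sumr_ge0 => k _; apply: sumr_ge0 => l _; exact: sqr_ge0.
  have h2 : 0 <= lambda * (\sum_(k < 3) a k k x) ^+ 2.
    by rewrite mulr_ge0 ?sqr_ge0 // ltW.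
  apply/eqP; rewrite eq_le h1 andbT.
  have : mu / 2 * (\sum_(i < 3) \sum_(j < 3) (a i j x + a j i x) ^+ 2) <= 0.
    by rewrite -[leRHS]H /dissipation lerDl.
  by rewrite pmulr_rle0 // divr_gt0.
have rows k : 0 <= \sum_(l < 3) (a k l x + a l k x) ^+ 2.
  by apply: sumr_ge0 => l _; exact: sqr_ge0.
have row_i : \sum_(l < 3) (a i l x + a l i x) ^+ 2 = 0.
  exact: (psumr_eq0P (fun k _ => rows k) S0).
have /eqP : (a i j x + a j i x) ^+ 2 = 0.
  exact: (psumr_eq0P (fun l _ => sqr_ge0 (a i l x + a l i x)) row_i).
by rewrite sqrf_eq0 => /eqP.
Qed.

End Energy.

(** * The rotating solutions *)


Section Expr.
Variable R : realType.
Notation E := 'rV[R]_3.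
Implicit Types x y : E.

(* A class of functions closed under the partial derivatives; [Pow p] is the
   real power [p] of [c + k * (x_1^2 + x_2^2)]. *)
Inductive rexpr : Type :=
  | Cst of R
  | Coord of 'I_3
  | Add of rexpr & rexpr
  | Mul of rexpr & rexpr
  | Pow of R.

Variables c k : R.

Definition axis_base x : R := c + k * (x 0 0 ^+ 2 + x 0 1 ^+ 2).

Fixpoint reval (e : rexpr) x : R :=
  match e with
  | Cst a => a
  | Coord i => x 0 i
  | Add e1 e2 => reval e1 x + reval e2 x
  | Mul e1 e2 => reval e1 x * reval e2 x
  | Pow p => axis_base x `^ p
  end.

Definition axis_slope (i : 'I_3) : R := 2 * k * (i != 2)%:R.

Fixpoint rderiv (i : 'I_3) (e : rexpr) : rexpr :=
  match e with
  | Cst _ => Cst 0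
  | Coord j => Cst (i == j)%:R
  | Add e1 e2 => Add (rderiv i e1) (rderiv i e2)
  | Mul e1 e2 => Add (Mul e1 (rderiv i e2)) (Mul e2 (rderiv i e1))
  | Pow p => Mul (Mul (Cst p) (Pow (p - 1))) (Mul (Cst (axis_slope i)) (Coord i))
  end.

Hypotheses (c_gt0 : 0 < c) (k_ge0 : 0 <= k).

Lemma axis_base_gt0 x : 0 < axis_base x.
Proof. by rewrite ltr_wpDr // mulr_ge0 // addr_ge0 // sqr_ge0. Qed.

Lemma C1_axis_base : C1 [set: E] axis_base (fun i x => axis_slope i * x 0 i).
Proof.
have h j := C1M (@C1_coord R [set: E] j) (@C1_coord R [set: E] j).
apply: C1_ext (C1D (C1_cst _ c) (C1Z k (C1D (h 0) (h 1)))) _ _.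
- by move=> x; rewrite /axis_base !expr2.
- by move=> i x; move: i; apply: ord3_ind; rewrite /axis_slope /=; ring.
Qed.

Lemma C1_reval e : C1 [set: E] (reval e) (fun i => reval (rderiv i e)).
Proof.
elim: e => [a|j|e1 h1 e2 h2|e1 h1 e2 h2|p].
- exact: C1_cst.
- exact: C1_coord.
- exact: C1D.
- exact: C1M.
have [cB cB' dB] := C1_axis_base.
have cP q : continuous (fun x => axis_base x `^ q).
  have cBT : continuous (axis_base : E -> R) by apply/continuous_subspace_setT.
  move=> x.
  apply: (@continuous_comp _ _ _ axis_base (fun t : R => t `^ q)); first exact: cBT.
  by have := is_derive1_powR q (axis_base_gt0 x); exact: derive_cont.
split => [|i|i x Ox].
- by apply: continuous_subspaceT; exact: cP.
- apply: within_contM; last exact: cB'.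
  by apply: within_contM; [case: (C1_cst [set: E] p)|apply: continuous_subspaceT; exact: cP].
- apply: (@is_derive_comp1 R (fun t : R => t `^ p)); last exact: dB.
  exact: is_derive1_powR (axis_base_gt0 x).
Qed.

(** The syntactic derivative can be iterated, so it supplies the whole tower of derivatives that
    [smooth] asks for. *)
Lemma smooth_reval e : smooth (reval e).
Proof.
exists (fun s => reval (foldr rderiv e s)); split=> // [s|s i x Ox].
  have [h _ _] := C1_reval (foldr rderiv e s).
  exact: (continuous_subspaceW (@subsetT _ _) h).
by have [_ _ d] := C1_reval (foldr rderiv e s); exact: d.
Qed.

End Expr.

Section Rotating.
Variable R : realType.
Notation E := 'rV[R]_3.
Implicit Types x y : E.
Variables (gamma mu lambda rho0 omega : R).
Hypotheses (gamma_gt1 : 1 < gamma) (rho0_gt0 : 0 < rho0).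

Let c := rho0 `^ (gamma - 1).
Let k := (gamma - 1) / (2 * gamma) * omega ^+ 2.
Let rho := rotating_density gamma rho0 omega.
Let u := rotating_velocity omega.

Let c_gt0 : 0 < c. Proof. exact: powR_gt0. Qed.
Let gamma_gt0 : 0 < gamma. Proof. exact: lt_trans ltr01 gamma_gt1. Qed.
Let gamma1_gt0 : 0 < gamma - 1. Proof. by rewrite subr_gt0. Qed.
Let k_ge0 : 0 <= k.
Proof. by rewrite mulr_ge0 ?sqr_ge0 // divr_ge0 ?mulr_ge0 // ltW. Qed.

Lemma rotating_densityE : rho = reval c k (Pow (1 / (gamma - 1))).
Proof.
apply/funext => x; rewrite /rho /rotating_density /= /axis_base /axis_dist.
by rewrite sqr_sqrtr // addr_ge0 // sqr_ge0.
Qed.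

Lemma rotating_density_gt0 x : 0 < rho x.
Proof. by rewrite rotating_densityE /=; apply: powR_gt0; exact: axis_base_gt0. Qed.

Lemma rotating_density_smooth : smooth rho.
Proof. by rewrite rotating_densityE; exact: smooth_reval. Qed.

Lemma rotating_density_cont : {within @Omega_bar R, continuous rho}.
Proof.
rewrite rotating_densityE.
have [h _ _] := C1_reval c_gt0 k_ge0 (Pow (1 / (gamma - 1))).
exact: (continuous_subspaceW (@subsetT _ _) h).
Qed.

Lemma rotating_velocityE x :
  (u x 0 0 = omega * x 0 1) * (u x 0 1 = - (omega * x 0 0)) * (u x 0 2 = 0).
Proof. by rewrite /u /rotating_velocity /vec3 !mxE /= mulrN mulr0. Qed.

Definition rotation_grad (i j : 'I_3) : R :=
  omega * ((i == 0) && (j == 1))%:R - omega * ((i == 1) && (j == 0))%:R.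

Lemma C1_rotating_velocity A i : C1 A (fun x => u x 0 i) (fun j _ => rotation_grad i j).
Proof.
move: i; apply: ord3_ind.
- apply: C1_ext (C1Z omega (@C1_coord R A 1)) _ _ => [x|j x].
    by rewrite rotating_velocityE.
  by rewrite /rotation_grad /= mulr0 subr0.
- apply: C1_ext (C1Z (- omega) (@C1_coord R A 0)) _ _ => [x|j x].
    by rewrite rotating_velocityE mulNr.
  by rewrite /rotation_grad /= mulr0 sub0r mulNr.
- apply: C1_ext (C1_cst A 0) _ _ => [x|j x]; first by rewrite rotating_velocityE.
  by rewrite /rotation_grad /= mulr0 subr0.
Qed.

Lemma rotating_velocity_smooth : smoothv u.
Proof.
apply: ord3_ind.
- have -> : (fun x => u x 0 0) = reval 1 0 (Mul (Cst omega) (Coord R 1)).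
    by apply/funext => x; rewrite rotating_velocityE.
  exact: smooth_reval.
- have -> : (fun x => u x 0 1) = reval 1 0 (Mul (Cst (- omega)) (Coord R 0)).
    by apply/funext => x; rewrite rotating_velocityE /= mulNr.
  exact: smooth_reval.
- have -> : (fun x => u x 0 2) = reval 1 0 (Cst 0).
    by apply/funext => x; rewrite rotating_velocityE.
  exact: smooth_reval.
Qed.

Lemma rotating_stress x : Omega x -> stress mu lambda u x = 0.
Proof.
move=> Ox; apply/matrixP => i j; rewrite /stress /div !mxE.
have p i' j' : partial i' (fun y => u y 0 j') x = rotation_grad j' i'.
  exact: (C1_partial i' (C1_rotating_velocity (@Omega R) j') Ox).
rewrite sum3 !p /rotation_grad /=.
by move: i j; apply: ord3_ind; apply: ord3_ind; rewrite /=; ring.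
Qed.

Let r i x := 1 / (gamma - 1) * axis_base c k x `^ (1 / (gamma - 1) - 1) *
  (axis_slope k i * x 0 i).

Lemma C1_rotating_density : C1 [set: E] rho r.
Proof. by rewrite rotating_densityE; exact: C1_reval. Qed.

(** The pressure gradient must equal the centripetal force. The exponent gamma/(gamma - 1) - 1 =
    1/(gamma - 1) returns the density, and the factor (gamma - 1)/(2 gamma) in [k] leaves exactly
    omega^2. *)
Lemma rotating_pressure i x : Omega x ->
  partial i (fun y => rho y `^ gamma) x = omega ^+ 2 * (i != 2)%:R * x 0 i * rho x.
Proof.
move=> Ox.
have -> : (fun y => rho y `^ gamma) = reval c k (Pow (1 / (gamma - 1) * gamma)).
  by apply/funext => y; rewrite rotating_densityE /= -powRrM.
rewrite (C1_partial i (C1_reval c_gt0 k_ge0 _) Ox) rotating_densityE /=.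
have -> : 1 / (gamma - 1) * gamma - 1 = 1 / (gamma - 1).
  by field; rewrite gt_eqF.
rewrite /axis_slope /k; field.
by rewrite !gt_eqF.
Qed.

Lemma rotating_solution : stationary_solution gamma mu lambda rho u.
Proof.
have C1rho : C1 (@Omega R) rho r by apply: C1W C1_rotating_density => x.
have C1u := C1_rotating_velocity (@Omega R).
split.
- exact: rotating_density_smooth.
- exact: rotating_velocity_smooth.
- move=> x Ox; rewrite /div.
  have p i : partial i (fun y => (rho y *: u y) 0 i) x = rho x * rotation_grad i i + u x 0 i * r i x.
    by apply: (C1_partial_eq i (C1M C1rho (C1u i))) => // y _; rewrite mxE.
  rewrite sum3 !p !rotating_velocityE /rotation_grad /r /axis_slope /=; ring.
- move=> x Ox; apply/rowP => i; rewrite /divm /grad !mxE rotating_pressure //.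
  rewrite [RHS]big1; last first.
    move=> j _; rewrite (C1_partial_eq j (C1_cst (@Omega R) 0)) // => y Oy.
    by rewrite rotating_stress // mxE.
  have p j : partial j (fun y => (rho y *: tensor (u y) (u y)) i j) x =
      rho x * (u x 0 i * rotation_grad j j + u x 0 j * rotation_grad i j)
      + u x 0 i * u x 0 j * r j x.
    apply: (C1_partial_eq j (C1M C1rho (C1M (C1u i) (C1u j)))) => // y _.
    by rewrite /tensor !mxE big_ord1 !mxE.
  rewrite sum3 !p !rotating_velocityE /rotation_grad /r /axis_slope /=.
  by move: i {p}; apply: ord3_ind; rewrite !rotating_velocityE /=; ring.
- by move=> x _; rewrite dotvE !rotating_velocityE /normal; ring.
- move=> x tau Gx _.
  have -> : tracem (stress mu lambda u) x = 0.
    apply/matrixP => i j; rewrite !mxE.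
    have [c0 _ _] := C1_cst (@Omega_bar R) 0.
    by apply: (trace_cont c0 _ Gx) => y Oy; rewrite rotating_stress // mxE.
  by rewrite trmx0 mulmx0 dotvE !mxE !mulr0 !addr0.
Qed.

End Rotating.

(** * Rigidity *)


Section Converse.
Variable R : realType.
Notation E := 'rV[R]_3.
Implicit Types x y : E.

Lemma smooth_C1 (f : E -> R) : smooth f ->
  exists D : ('I_3 -> E -> R) * ('I_3 -> 'I_3 -> E -> R),
    C1 (@Omega_bar R) f D.1 /\ forall i, C1 (@Omega_bar R) (D.1 i) (D.2 i).
Proof.
move=> [D [<- c d]]; exists (fun i => D [:: i], fun i j => D [:: j; i]).
by split=> [|i]; split=> [|j|j x]; by [exact: c|exact: d].
Qed.

Variables (gamma mu lambda : R) (rho : E -> R) (u : E -> E).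
Hypotheses (gamma_gt1 : 1 < gamma) (mu_gt0 : 0 < mu) (lambda_gt0 : 0 < lambda).
Hypothesis sol : stationary_solution gamma mu lambda rho u.
Hypothesis rho_gt0 : forall x, Omega x -> 0 < rho x.

Lemma coord_delta (i j : 'I_3) : (evec R i) 0 j = (i == j)%:R.
Proof. by rewrite /evec mxE eqxx eq_sym. Qed.

Lemma rigid_velocity : exists r a b,
  [/\ C1 (@Omega_bar R) rho r,
      forall i, C1 (@Omega_bar R) (fun x => u x 0 i) (a i),
      forall i j, C1 (@Omega_bar R) (a i j) (b i j),
      (forall i j x, Omega x -> a i j x + a j i x = 0) /\
      (forall i j x, Omega x -> a i j x = a i j 0) /\
      (forall i j k x, Omega x -> b i j k x = 0) &
      forall i x, Omega_bar x -> u x 0 i = \sum_(j < 3) a i j 0 * x 0 j].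
Proof.
have [[r r'] /= [C1rho _]] := smooth_C1 (sol_smooth_density sol).
have /choice[D hD] := fun i => smooth_C1 (sol_smooth_velocity sol i).
pose a i := (D i).1; pose b i := (D i).2.
have C1u i : C1 (@Omega_bar R) (fun x => u x 0 i) (a i) by have [h _] := hD i; exact: h.
have C1a i j : C1 (@Omega_bar R) (a i j) (b i j) by have [_ h] := hD i; exact: h.
exists r, a, b.
have skew := strain_eq0 gamma_gt1 mu_gt0 lambda_gt0 sol rho_gt0 C1rho C1u C1a.
have [b0 a0 u0] := killing_affine (fun i => C1W (@Omega_sub_bar R) (C1u i))
  (fun i j => C1W (@Omega_sub_bar R) (C1a i j)) skew.
have aff i x : Omega_bar x -> u x 0 i = u 0 0 i + \sum_(j < 3) a i j 0 * x 0 j.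
  have [cu _ _] := C1u i.
  have [cA _ _] := C1D (C1_cst (@Omega_bar R) (u 0 0 i))
     (C1_sum (fun j => C1Z (a i j 0) (@C1_coord R (@Omega_bar R) j))).
  by apply: (eq_Omega_bar cu cA) => y Oy; exact: u0.
(* Impermeability at the pole e_i reads u_i(0) + a_ii = 0, and a_ii = 0 by skewness. *)
have c0 i : u 0 0 i = 0.
  have Gi : Gamma (evec R i).
    by apply/GammaE; rewrite /sqnorm !coord_delta; move: i; apply: ord3_ind;
      rewrite /= !(expr1n, expr0n) /= ?addr0 ?add0r.
  have := sol_impermeable sol Gi; rewrite /dotv /normal.
  rewrite (bigD1 i) //= big1 => [|j /negbTE ji]; last first.
    by rewrite coord_delta eq_sym ji mulr0.
  rewrite coord_delta eqxx mulr1 addr0 (aff i _ (Gamma_sub_bar Gi)).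
  rewrite (bigD1 i) //= big1 => [|j /negbTE ji]; last first.
    by rewrite coord_delta eq_sym ji mulr0.
  have := skew i i 0 (Omega0 R).
  by rewrite coord_delta eqxx mulr1 addr0; lra.
split; [exact: C1rho|exact: C1u|exact: C1a|exact: (conj skew (conj a0 b0))|].
by move=> i x Ox; rewrite aff // c0 add0r.
Qed.

Lemma gradv_skew : forall x, Omega x -> gradv u x + (gradv u x)^T = 0.
Proof.
have [r [a [b [_ C1u _ [skew _] _]]]] := rigid_velocity.
move=> x Ox; apply/matrixP => i j; rewrite !mxE.
by rewrite (C1_partial j (C1u i) Ox) (C1_partial i (C1u j) Ox) skew.
Qed.

Lemma velocity_crossv : exists w, forall x, Omega_bar x -> u x = crossv x w.
Proof.
have [r [a [b [_ _ _ [skew _] uE]]]] := rigid_velocity.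
(* The axial vector of the skew matrix [a], in the sign convention of x cross w. *)
exists (vec3 (a 1 2 0) (a 2 0 0) (a 0 1 0)) => x Ox.
have s i j := skew i j 0 (Omega0 R).
have s00 := s 0 0; have s11 := s 1 1; have s22 := s 2 2.
have s01 := s 0 1; have s12 := s 1 2; have s20 := s 2 0.
have d0 i : a i i 0 + a i i 0 = 0 -> a i i 0 = 0 by lra.
have e10 : a 1 0 0 = - a 0 1 0 by lra.
have e21 : a 2 1 0 = - a 1 2 0 by lra.
have e02 : a 0 2 0 = - a 2 0 0 by lra.
apply: rowP3; rewrite uE // sum3 /crossv !vec3E ?(d0 _ s00) ?(d0 _ s11) ?(d0 _ s22).
- by rewrite e02; ring.
- by rewrite e10; ring.
- by rewrite e21; ring.
Qed.

Lemma crossv_e3 (omega : R) x : crossv x (omega *: e3 R) = rotating_velocity omega x.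
Proof.
by apply: rowP3; rewrite /crossv vec3E /rotating_velocity /e3 !mxE /=; ring.
Qed.

(** For a rigid velocity div S = 0, so the momentum equation says that rho^(gamma - 1) - k r^2 has
    zero gradient; its value at 0 then fixes the density. *)
Lemma rotating_density_unique (omega : R) :
  (forall x, Omega_bar x -> u x = rotating_velocity omega x) ->
  forall x, Omega_bar x -> rho x = rotating_density gamma (rho 0) omega x.
Proof.
move=> uE.
have [r [a [b [C1rho C1u C1a [skew [_ b0]] _]]]] := rigid_velocity.
have rho0 := rho_gt0 (Omega0 R).
have g0 : 0 < gamma := lt_trans ltr01 gamma_gt1.
have g1 : 0 < gamma - 1 by rewrite subr_gt0.
have aE i j x : Omega x -> a i j x = rotation_grad omega i j.
  move=> Ox; rewrite -(C1_partial j (C1u i) Ox).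
  apply: (C1_partial_eq j (C1_rotating_velocity omega (@Omega R) i)) => // y Oy.
  by rewrite uE //; exact: Omega_sub_bar.
have grad_rho i x : Omega x ->
    gamma * rho x `^ (gamma - 1) * r i x = rho x * (omega ^+ 2 * (i != 2)%:R * x 0 i).
  move=> Ox; have C := continuity_eq sol C1rho C1u Ox.
  have := momentum_eq sol rho_gt0 C1rho C1u C1a i Ox.
  rewrite [RHS]big1; last first.
    move=> j _; rewrite /stress_entry' !b0 // big1; last by move=> l _; rewrite b0.
    by rewrite !(mulr0, addr0).
  move=> H.
  (* Subtracting u_i times the continuity equation reduces div(rho u (x) u) to rho (u . grad) u. *)
  have := congr1 (fun z => u x 0 i * z) C; rewrite mulr0 => C'.
  move: H C'; rewrite !sum3 !aE // (uE _ (Omega_sub_bar Ox)).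
  rewrite !rotating_velocityE /rotation_grad.
  move: i; apply: ord3_ind; rewrite /= !rotating_velocityE => H C'; lra.
pose k := (gamma - 1) / (2 * gamma) * omega ^+ 2.
have rhoO : C1 (@Omega R) rho r := C1W (@Omega_sub_bar R) C1rho.
have h := C1D (C1_powR (gamma - 1) rhoO rho_gt0)
  (C1Z (-1) (@C1W R _ _ _ (fun x _ => I) (C1_axis_base 0 k))).
have key x : Omega x ->
    rho x `^ (gamma - 1) = rho 0 `^ (gamma - 1) + k * (x 0 0 ^+ 2 + x 0 1 ^+ 2).
  move=> Ox; have := C1_const h _ Ox; rewrite /axis_base !mxE => H.
  have {}H : rho x `^ (gamma - 1) + -1 * (0 + k * (x 0 0 ^+ 2 + x 0 1 ^+ 2)) =
     rho 0 `^ (gamma - 1) + -1 * (0 + k * (0 ^+ 2 + 0 ^+ 2)).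
    apply: H => i y Oy; have ry := rho_gt0 Oy.
    have := grad_rho i y Oy; rewrite -(mulr_powRB1 (ltW ry) g1) => e.
    (* Multiplying by rho replaces the exponent gamma - 2 by the gamma - 1 of [grad_rho]. *)
    apply: (mulfI (lt0r_neq0 ry)); rewrite mulr0 /axis_slope /k.
    have -> : rho y * ((gamma - 1) * rho y `^ (gamma - 1 - 1) * r i y +
       -1 * (2 * ((gamma - 1) / (2 * gamma) * omega ^+ 2) * (i != 2)%:R * y 0 i)) =
       (gamma - 1) / gamma * (gamma * (rho y * rho y `^ (gamma - 1 - 1)) * r i y
         - rho y * (omega ^+ 2 * (i != 2)%:R * y 0 i)).
      by field; rewrite gt_eqF.
    by rewrite e subrr mulr0.
  by move: H; rewrite !expr0n /= !addr0 mulr0; lra.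
(* Both sides are continuous on the closed ball, so the formula passes to the sphere, where
   positivity of the density is not given. *)
have [c_rho _ _] := C1rho.
have c_rot := @rotating_density_cont R gamma (rho 0) omega gamma_gt1 rho0.
have H := @eq_Omega_bar R rho (rotating_density gamma (rho 0) omega) c_rho c_rot.
apply: H => x Ox.
rewrite /rotating_density /axis_dist sqr_sqrtr ?addr_ge0 ?sqr_ge0 // -/k -key //.
rewrite -powRrM mulrA mulr1 divff ?gt_eqF // powRr1 //.
by apply: ltW; exact: rho_gt0.
Qed.

End Converse.

Theorem mainTheorem2 (R : realType) (gamma mu lambda : R)
    (gamma_gt1 : 1 < gamma) (mu_gt0 : 0 < mu) (lambda_gt0 : 0 < lambda) :
  (forall rho0 omega : R, 0 < rho0 -> 0 <= omega ->
     stationary_solution gamma mu lambda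
       (rotating_density gamma rho0 omega) (rotating_velocity omega)
     /\ (forall x, Omega_bar x -> 0 < rotating_density gamma rho0 omega x))
  /\
  (forall (rho : 'rV[R]_3 -> R) (u : 'rV[R]_3 -> 'rV[R]_3),
     stationary_solution gamma mu lambda rho u ->
     (forall x, Omega x -> 0 < rho x) ->
     (forall x, Omega x -> gradv u x + (gradv u x)^T = 0)
     /\ exists a : 'rV[R]_3,
          (forall x, Omega_bar x -> u x = crossv x a)
          /\ (forall omega : R, 0 <= omega -> a = omega *: e3 R ->
                0 < rho 0
                /\ (forall x, Omega_bar x ->
                      rho x = rotating_density gamma (rho 0) omega x
                      /\ u x = rotating_velocity omega x))).
Proof.
split=> [rho0 omega rho0_gt0 _|rho u sol rho_gt0].
  split; first exact: rotating_solution.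
  by move=> x _; exact: rotating_density_gt0.
split; first exact: gradv_skew sol rho_gt0.
have [a uE] := velocity_crossv gamma_gt1 mu_gt0 lambda_gt0 sol rho_gt0.
exists a; split => // omega _ ae; split; first exact/rho_gt0/Omega0.
have uR x : Omega_bar x -> u x = rotating_velocity omega x.
  by move=> Ox; rewrite uE // ae crossv_e3.
move=> x Ox; split; last exact: uR.
exact: (rotating_density_unique gamma_gt1 mu_gt0 lambda_gt0 sol rho_gt0 uR).
Qed.
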